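(* Let $\varphi$ be a tame recognisable substitution with tiling space $\Omega=\Omega_\varphi$, and let $N_\varphi=1+\max_{u\in B}|u|$. The map $h:\Omega\to\varprojlim(\Gamma_{N_\varphi},f_{N_\varphi})$ given by $$h(x)=\bigl(p_{N_\varphi}(x),\,p_{N_\varphi}(\varphi^{-1}(x)),\,p_{N_\varphi}(\varphi^{-2}(x)),\ldots\bigr)$$ is a homeomorphism.
   Context: Substitutions. A substitution on a finite alphabet $\mathcal{A}$ is a function $\varphi:\mathcal{A}\to\mathcal{A}^+$ (non-empty finite words), extended by concatenation to words and to $\mathcal{A}^{\mathbb{Z}}$ (with the image of the letter at index $0$ starting at index $0$). A word is admitted if it is a subword of $\varphi^k(a)$ for some $a\in\mathcal{A}$, $k\ge0$. $X_\varphi$ is the set of $w\in\mathcal{A}^{\mathbb{Z}}$ all of whose finite subwords are admitted, with the subspace topology and shift $\sigma(w)_i=w_{i+1}$. A word is legal if it is a subword of an element of $X_\varphi$. A word $u\in \mathcal{A}^+$ is bounded if $\sup_n|\varphi^n(u)|<\infty$, and expanding otherwise. $B$ is the set of bounded legal words; $\varphi$ is tame if $B$ is finite. If $B=\emptyset$ the maximum of $|u|$ over $B$ is taken to be $0$. Tiling space. $\Omega_\varphi=(X_\varphi\times[0,1])/{\sim}$ with $\sim$ generated by $(w,1)\sim(\sigma(w),0)$; points are written $(w,t)$ with $t\in[0,1)$. The continuous map $\varphi:\Omega_\varphi\to\Omega_\varphi$ is $\varphi(w,t)=(\sigma^{\lfloor\tilde t\rfloor}(\varphi(w)),\tilde t-\lfloor\tilde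 t\rfloor)$ with $\tilde t=|\varphi(w_0)|\,t$. $\varphi$ is recognisable if this map is injective (the map is then a homeomorphism of $\Omega_\varphi$, and $\varphi^{-1}$ denotes its inverse). Collaring. Fix a letter $b\in\mathcal{A}$. For $n\ge0$, an $n$-collared letter $a_u$ is a word $u\in\mathcal{A}^{2n+1}$ together with its central letter $a$. Define $\varphi_n'$ on $\mathcal{A}^{2n+1}$: if $\varphi(a)=b_1\cdots b_k$, then $\varphi_n'(a_u)=(b_1)_{b_1(n)}\cdots(b_k)_{b_k(n)}$, where $b_i(n)$ is the length-$(2n+1)$ subword of $\varphi(u)$ centred at the letter $b_i$ of the block $\varphi(a)$ coming from the central letter of $u$. Let $\mathcal{A}_n'$ be the set of $a_u$ with $u$ legal, $\mathcal{A}_n''$ the set of $a_u$ with $u=b^n a b^n$ and $a$ an illegal letter, and $\mathcal{A}_n$ the set of $n$-collared letters appearing in $\varphi_n'^k(c_v)$ for some $k\ge0$ and $c_v\in\mathcal{A}_n'\cup\mathcal{A}_n''$. The $n$-collared substitution $\varphi_n$ on $\mathcal{A}_n$ is the restriction of $\varphi_n'$. Let $\iota_n:X_\varphi\to\mathcal{A}_n^{\mathbb{Z}}$ replace each letter of $w$ by the $n$-collared letter given by the length-$(2n+1)$ subword of $w$ centred at it; it is a topological conjugacy onto $X_{\varphi_n}$, and we identify $\Omega_\varphi$ with $\Omega_{\varphi_n}$ via $(w,t)\mapsto(\iota_n(w),t)$. Anderson–Putnam complex. The Anderson–Putnam complex of a substitution $\varphi$ is the quotient of $\Omega_\varphi$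 by the transitive closure of the relation: $(w,t)\sim(w',t')$ if $t=t'\in(0,1)$ and $w_0=w_0'$, or $t=t'=0$ and ($w_{-1}=w'_{-1}$ or $w_0=w_0'$). $\Gamma_n$ is the Anderson–Putnam complex of $\varphi_n$, $p_n:\Omega_\varphi\cong\Omega_{\varphi_n}\to\Gamma_n$ is the quotient map, and $f_n:\Gamma_n\to\Gamma_n$ is the unique map with $f_n\circ p_n=p_n\circ\varphi$. $\varprojlim(\Gamma,f)=\{(x_0,x_1,\ldots)\in\Gamma^{\mathbb{N}}: f(x_{i+1})=x_i\ \forall i\}$. *)

(* Defs.v *)
From HB Require Import structures.
From Stdlib Require Import Relation_Operators.
From mathcomp Require Import all_boot all_order all_algebra.
From mathcomp Require Import all_classical all_reals all_analysis.
From mathcomp Require Import zify.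

Set Implicit Arguments.
Unset Strict Implicit.
Unset Printing Implicit Defensive.

Import Order.TTheory GRing.Theory Num.Theory.
Import numFieldNormedType.Exports.

Local Open Scope classical_set_scope.
Local Open Scope ring_scope.
Local Open Scope quotient_scope.

Record substitution (A : finType) := Substitution {
  subst_letter :> A -> seq A;
  subst_letter_neq0 : forall a, subst_letter a != [::] }.

Section Words.
Context {A : finType}.
Implicit Types (phi : substitution A) (u v : seq A) (w : int -> A).

Definition subst_word phi u : seq A := flatten [seq phi a | a <- u].

Definition window w (i : int) (m : nat) : seq A :=
  mkseq (fun j => w (i + j%:Z)) m.

Definition admitted phi u : Prop :=
  exists a k, infix u (iter k (subst_word phi) [:: a]).

Definition subshift phi : set {ptws int -> discrete_topology A} :=
  [set w | forall i m, admitted phi (window w i m)].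

Definition shift (k : int) w : int -> A := fun i => w (i + k).

(* The letters of non-negative index are read from phi(w_0)phi(w_1)..., those
   of negative index from ...phi(w_{-2})phi(w_{-1}); since images are non-empty,
   k.+1 blocks are enough to reach the letter of index k (resp. -(k+1)). *)
Definition subst_seq phi w (i : int) : A :=
  match i with
  | Posz k => nth (w 0) (subst_word phi (window w 0 k.+1)) k
  | Negz k => let s := subst_word phi (window w (Negz k) k.+1) in
              nth (w 0) s (size s - k.+1)
  end.

Definition legal phi u : Prop :=
  exists2 w, subshift phi w & exists i, u = window w i (size u).

Definition bounded_word phi u : Prop :=
  exists M, forall n, (size (iter n (subst_word phi) u) <= M)%N.

Definition bounded_legal phi : set (seq A) :=
  [set u | [/\ u != [::], bounded_word phi u & legal phi u]].

Definition tame phi : Prop := finite_set (bounded_legal phi).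

Definition collar_radius phi : nat :=
  (1 + \big[maxn/0]_(u \in bounded_legal phi) size u)%N.

Lemma subst_word_cat phi u v :
  subst_word phi (u ++ v) = subst_word phi u ++ subst_word phi v.
Proof. by rewrite /subst_word map_cat flatten_cat. Qed.

Lemma size_subst_word phi u : (size u <= size (subst_word phi u))%N.
Proof.
elim: u => // a u IH; rewrite /subst_word /= size_cat -add1n leq_add //.
by rewrite lt0n size_eq0 subst_letter_neq0.
Qed.

Lemma iter_subst_cat phi k u v :
  iter k (subst_word phi) (u ++ v) =
  iter k (subst_word phi) u ++ iter k (subst_word phi) v.
Proof. by elim: k => //= k ->; rewrite subst_word_cat. Qed.

Lemma size_iter_subst phi k u : (size u <= size (iter k (subst_word phi) u))%N.
Proof. by elim: k => //= k /leq_trans; apply; apply: size_subst_word. Qed.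

Lemma infix_subst phi u v :
  infix u v -> infix (subst_word phi u) (subst_word phi v).
Proof.
by move=> /infixP[p [s ->]]; rewrite !subst_word_cat; apply/infixP; do 2!eexists.
Qed.

Lemma size_window w i m : size (window w i m) = m.
Proof. exact: size_mkseq. Qed.

Lemma nth_window d w i m j : (j < m)%N -> nth d (window w i m) j = w (i + j%:Z).
Proof. by move=> jm; rewrite nth_mkseq. Qed.

Lemma window_cat w i m p :
  window w i (m + p) = window w i m ++ window w (i + m%:Z) p.
Proof.
apply: (@eq_from_nth _ (w 0)) => [|j].
  by rewrite size_cat !size_window.
rewrite size_window => jm; rewrite nth_cat size_window nth_window //.
case: ltnP => mj; rewrite nth_window //; last by lia.
by congr w; lia.
Qed.

Lemma window_shift k w i m : window (shift k w) i m = window w (i + k) m.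
Proof. by apply: eq_mkseq => j; rewrite /shift; congr w; lia. Qed.

Lemma subshift_shift phi k w : subshift phi w -> subshift phi (shift k w).
Proof. by move=> Xw i m; rewrite window_shift; apply: Xw. Qed.

Lemma admitted_infix phi u v : infix u v -> admitted phi v -> admitted phi u.
Proof.
by move=> uv [a [k vk]]; exists a, k; apply: infix_trans uv vk.
Qed.

Lemma subst_seq_pos phi w d k m : (k < size (subst_word phi (window w 0 m)))%N ->
  subst_seq phi w k%:Z = nth d (subst_word phi (window w 0 m)) k.
Proof.
have P n p j : (j < size (subst_word phi (window w 0 n)))%N ->
  nth (w 0) (subst_word phi (window w 0 (n + p))) j =
  nth (w 0) (subst_word phi (window w 0 n)) j.
  by move=> jn; rewrite window_cat subst_word_cat nth_cat jn.
move=> km; rewrite (set_nth_default (w 0)) //=.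
have kk : (k < size (subst_word phi (window w 0 k.+1)))%N.
  by apply: leq_trans (size_subst_word _ _); rewrite size_window.
have [/subnKC <-|/ltnW/subnKC e] := leqP k.+1 m; first by rewrite P.
by rewrite -[k.+1 in LHS]e P.
Qed.

Lemma subst_seq_neg phi w d k n :
  (k < size (subst_word phi (window w (- n%:Z) n)))%N ->
  subst_seq phi w (- (k.+1)%:Z) =
  let s := subst_word phi (window w (- n%:Z) n) in nth d s (size s - k.+1).
Proof.
set P := fun n => subst_word phi (window w (- n%:Z) n).
have S n1 n2 j : (j < size (P n1))%N -> (n1 <= n2)%N ->
  nth (w 0) (P n2) (size (P n2) - j.+1) = nth (w 0) (P n1) (size (P n1) - j.+1).
  move=> jn n12; have {1 2}-> : P n2 =
      subst_word phi (window w (- n2%:Z) (n2 - n1)) ++ P n1.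
    rewrite /P -{2}(subnK n12) window_cat subst_word_cat; congr (_ ++ subst_word _ (window _ _ _)).
    lia.
  by rewrite size_cat nth_cat ifF; [congr nth|]; lia.
move=> km; cbv zeta; rewrite (set_nth_default (w 0)) -/(P n); last by rewrite -/(P n) in km; lia.
have kk : (k < size (P k.+1))%N.
  by apply: leq_trans (size_subst_word _ _); rewrite size_window.
have -> : (- k.+1%:Z) = Negz k by lia.
rewrite /subst_seq.
have -> : Negz k = - k.+1%:Z by lia.
rewrite -/(P k.+1).
have [nk|/ltnW kn] := leqP k.+1 n; first by rewrite (S _ _ _ kk nk).
by rewrite (S _ _ _ km kn).
Qed.

Lemma subst_seqE phi w d n m j :
  let L := subst_word phi (window w (- n%:Z) (n + m)) in
  (j < size L)%N ->
  subst_seq phi w (j%:Z - (size (subst_word phi (window w (- n%:Z) n)))%:Z) =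
  nth d L j.
Proof.
rewrite /= window_cat subst_word_cat addNr.
set P := subst_word _ _; set Q := subst_word _ _.
rewrite size_cat nth_cat => jL; case: ltnP => jP.
  have -> : j%:Z - (size P)%:Z = - ((size P - j.+1).+1)%:Z by lia.
  rewrite (@subst_seq_neg _ _ d _ n) -/P /=; last by lia.
  by congr nth; lia.
have -> : j%:Z - (size P)%:Z = (j - size P)%:Z by lia.
by rewrite (@subst_seq_pos _ _ d _ m) // -/Q; lia.
Qed.

Lemma subst_seq_shift phi w :
  subst_seq phi (shift 1 w) =1 shift (size (phi (w 0)))%:Z (subst_seq phi w).
Proof.
move=> i; rewrite /shift -/(shift 1 w).
have [n nE] : {n | n = (absz i).+1} by eexists.
set Pw := subst_word phi (window w (- n%:Z) n).
have eP : subst_word phi (window (shift 1 w) (- n.+1%:Z) n.+1) =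
    Pw ++ phi (w 0).
  rewrite window_shift -{2}addn1.
  have -> : - n.+1%:Z + 1 = - n%:Z by lia.
  rewrite window_cat subst_word_cat; congr (_ ++ _).
  by rewrite addNr /subst_word /window /mkseq /= addr0 cats0.
have sP : (n <= size Pw)%N.
  by apply: leq_trans (size_subst_word _ _); rewrite size_window.
pose j := absz (i + (size Pw)%:Z + (size (phi (w 0)))%:Z).
have ej : j%:Z = i + (size Pw)%:Z + (size (phi (w 0)))%:Z by lia.
have sL : (j < size (subst_word phi (window w (- n%:Z) (n + (1 + n)))))%N.
  rewrite !window_cat !subst_word_cat !size_cat -/Pw.
  rewrite [in w (_ + _)]addNr addr0 /=.
  set Y := size (subst_word _ _); set F := size (phi (w 0)) in ej *.
  have Yn : (n <= Y)%N.
    by apply: leq_trans (size_subst_word _ _); rewrite size_window.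
  move: ej; rewrite nE in Yn; rewrite addn0; clearbody Y F j; lia.
have -> : i = j%:Z - (size (subst_word phi (window (shift 1 w) (- n.+1%:Z) n.+1)))%:Z.
  by rewrite eP size_cat; lia.
have e2 : j%:Z - (size (subst_word phi (window (shift 1 w) (- n.+1%:Z) n.+1)))%:Z
    + (size (phi (w 0)))%:Z = j%:Z - (size Pw)%:Z.
  by rewrite eP size_cat; lia.
have e3 : window (shift 1 w) (- n.+1%:Z) (n.+1 + n) =
          window w (- n%:Z) (n + (1 + n)).
  by rewrite window_shift; congr window; lia.
rewrite (@subst_seqE phi (shift 1 w) (w 0) n.+1 n) ?e3 //.
by rewrite e2 (@subst_seqE phi w (w 0) n (1 + n)).
Qed.

Lemma subst_seq_window phi w i m : exists n p,
  infix (window (subst_seq phi w) i m) (subst_word phi (window w n p)).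
Proof.
pose n := absz i; pose p := (n + m)%N; exists (- n%:Z), (n + p)%N.
set L := subst_word _ _; set P := subst_word phi (window w (- n%:Z) n).
have sP : (n <= size P)%N.
  by apply: leq_trans (size_subst_word _ _); rewrite size_window.
have sL : (size P + p <= size L)%N.
  rewrite /L window_cat subst_word_cat size_cat leq_add2l.
  by apply: leq_trans (size_subst_word _ _); rewrite size_window.
pose j := absz (i + (size P)%:Z).
suff -> : window (subst_seq phi w) i m = take m (drop j L).
  by apply: infix_trans (infix_take _ _) (infix_drop _ _).
have jL : (j + m <= size L)%N by lia.
apply: (@eq_from_nth _ (w 0)) => [|l].
  by rewrite size_window size_takel // size_drop; lia.
rewrite size_window => lm; rewrite nth_window // nth_take // nth_drop.
rewrite -(@subst_seqE phi w (w 0) n p); last by rewrite -/L; lia.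
by congr subst_seq; rewrite -/P; lia.
Qed.

Lemma subshift_subst phi w : subshift phi w -> subshift phi (subst_seq phi w).
Proof.
move=> Xw i m; have [n [p inf]] := subst_seq_window phi w i m.
have [a [k ak]] := Xw n p; exists a, k.+1.
by apply: infix_trans inf _; apply: infix_subst.
Qed.

End Words.

Section Collaring.
Context {A : finType}.
Implicit Types (phi : substitution A) (n : nat).

(* A collared letter a_u is determined by the word u, so it is encoded by u. *)
Definition center n (u : n.*2.+1.-tuple A) : A := tnth u (inord n).

(* With u = l ++ a :: r and size l = n, the block phi(a) starts in phi(u) at
   index |phi(l)| >= n, so that the subtraction below is not truncated. *)
Definition collar_block phi n (u : n.*2.+1.-tuple A) : seq (n.*2.+1.-tuple A) :=
  mkseq (fun i => [tuple nth (center u) (subst_word phi u)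
                           (size (subst_word phi (take n u)) + i - n + j)
                  | j < n.*2.+1])
        (size (phi (center u))).

Lemma collar_block_neq0 phi n (u : n.*2.+1.-tuple A) :
  collar_block phi u != [::].
Proof. by rewrite -size_eq0 size_mkseq size_eq0 subst_letter_neq0. Qed.

Definition collared_ext phi n : substitution (n.*2.+1.-tuple A) :=
  Substitution (@collar_block_neq0 phi n).

Definition collared_seed phi (b : A) n (u : n.*2.+1.-tuple A) : Prop :=
  legal phi u \/
  exists2 a, ~ legal phi [:: a] & tval u = nseq n b ++ a :: nseq n b.

Definition collared_letter phi b n (u : n.*2.+1.-tuple A) : Prop :=
  exists v k, collared_seed phi b v /\
              u \in iter k (subst_word (collared_ext phi n)) [:: v].

Definition collar_alphabet phi b n : finType :=
  {u : n.*2.+1.-tuple A | `[< collared_letter phi b u >]}.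

(* By collar_subst_letterE, pmap insub drops no letter here. *)
Definition collar_subst_letter phi b n (u : collar_alphabet phi b n) :
    seq (collar_alphabet phi b n) :=
  pmap insub (collared_ext phi n (val u)).

Lemma collar_subst_letterE phi b n (u : collar_alphabet phi b n) :
  map val (collar_subst_letter u) = collared_ext phi n (val u).
Proof.
rewrite /collar_subst_letter (pmap_filter (insubK _)); apply/all_filterP.
apply/allP => v vu; rewrite isSome_insub; apply/asboolP.
have /asboolP[s [k [ss us]]] := valP u; exists s, k.+1; split=> //=.
by apply/flattenP; exists (collared_ext phi n (val u)) => //; apply: map_f.
Qed.

Lemma collar_subst_letter_neq0 phi b n (u : collar_alphabet phi b n) :
  collar_subst_letter u != [::].
Proof.
rewrite -size_eq0 -(size_map val) collar_subst_letterE size_eq0.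
exact: subst_letter_neq0.
Qed.

Definition collar_subst phi b n : substitution (collar_alphabet phi b n) :=
  Substitution (@collar_subst_letter_neq0 phi b n).

Lemma map_collar_subst phi b n s :
  map val (subst_word (collar_subst phi b n) s) =
  subst_word (collared_ext phi n) (map val s).
Proof.
by elim: s => //= u s IH; rewrite -[u :: s]cat1s subst_word_cat map_cat IH
   /subst_word /= cats0 collar_subst_letterE.
Qed.

Lemma map_iter_collar_subst phi b n k s :
  map val (iter k (subst_word (collar_subst phi b n)) s) =
  iter k (subst_word (collared_ext phi n)) (map val s).
Proof. by elim: k => //= k <-; rewrite map_collar_subst. Qed.

Definition collar_tuple n (w : int -> A) (i : int) : n.*2.+1.-tuple A :=
  [tuple w (i - n%:Z + (j : nat)%:Z) | j < n.*2.+1].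

Lemma collar_tupleE n w i :
  tval (collar_tuple n w i) = window w (i - n%:Z) n.*2.+1.
Proof.
apply: (@eq_from_nth _ (w 0)) => [|j]; first by rewrite size_tuple size_window.
rewrite size_tuple => jn; rewrite nth_window //.
by rewrite -[j]/(nat_of_ord (Ordinal jn)) -tnth_nth tnth_mktuple.
Qed.

Lemma collar_tuple_shift n k w i :
  collar_tuple n (shift k w) i = collar_tuple n w (i + k).
Proof.
by apply: eq_from_tnth => j; rewrite !tnth_mktuple /shift; congr w; lia.
Qed.

Lemma center_collar_tuple n w i : center (collar_tuple n w i) = w i.
Proof. by rewrite /center tnth_mktuple inordK; [congr w|]; lia. Qed.

Lemma legal_collar_tuple phi n w i :
  subshift phi w -> legal phi (collar_tuple n w i).
Proof.
by move=> Xw; exists w => //; exists (i - n%:Z); rewrite size_tuple collar_tupleE.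
Qed.

Lemma collared_letter_tuple phi b n w i :
  subshift phi w -> `[< collared_letter phi b (collar_tuple n w i) >].
Proof.
move=> Xw; apply/asboolP; exists (collar_tuple n w i), 0%N.
by split; [left; apply: legal_collar_tuple | rewrite /= mem_head].
Qed.

(* The collared letters of the block y inside x ++ y ++ z. *)
Definition collars (d : A) n (x y z : seq A) : seq (n.*2.+1.-tuple A) :=
  mkseq (fun i => [tuple nth d (x ++ y ++ z) (size x + i - n + j)
                  | j < n.*2.+1]) (size y).

Lemma collars_eq n d d' x y z x' z' p q p' q' :
  (n <= size x)%N -> (n <= size z)%N -> (n <= size x')%N -> (n <= size z')%N ->
  p ++ (x ++ y ++ z) ++ q = p' ++ (x' ++ y ++ z') ++ q' ->
  (size p + size x = size p' + size x')%N ->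
  collars d n x y z = collars d' n x' y z'.
Proof.
move=> nx nz nx' nz' e s.
apply: (@eq_from_nth _ [tuple d | _ < n.*2.+1]); rewrite !size_mkseq // => i iy.
rewrite !nth_mkseq //; apply: eq_from_tnth => j; rewrite !tnth_mktuple.
have jn : (j < n.*2.+1)%N by [].
have E (b c u v : seq A) (d1 : A) : (n <= size b)%N -> (n <= size c)%N ->
  nth d1 (b ++ y ++ c) (size b + i - n + j) =
  nth d (u ++ (b ++ y ++ c) ++ v) (size u + size b + i - n + j).
  move=> nb nc.
  have lt : (size b + i - n + j < size (b ++ y ++ c))%N.
    by rewrite !size_cat; lia.
  rewrite (set_nth_default d) // [RHS]nth_cat ifF; last by lia.
  have -> : (size u + size b + i - n + j - size u = size b + i - n + j)%N by lia.
  by rewrite [RHS]nth_cat lt.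
by rewrite (E x z p q) // (E x' z' p' q') // e s.
Qed.

Lemma collars_cat n d x y1 y2 z :
  collars d n x (y1 ++ y2) z =
  collars d n x y1 (y2 ++ z) ++ collars d n (x ++ y1) y2 z.
Proof.
rewrite /collars size_cat /mkseq iotaD map_cat !catA; congr (_ ++ _).
rewrite add0n -[X in iota X _]addn0 iotaDl -map_comp; apply: eq_map => i /=.
by rewrite size_cat addnA.
Qed.

Lemma collar_blockE phi n d (u : n.*2.+1.-tuple A) x a z :
  tval u = x ++ a :: z -> size x = n ->
  collar_block phi u =
  collars d n (subst_word phi x) (phi a) (subst_word phi z).
Proof.
move=> ue xn; have zn : size z = n.
  have := size_tuple u; rewrite ue size_cat /=; lia.
have ca : center u = a.
  by rewrite /center (tnth_nth d) ue inordK ?nth_cat ?xn ?ltnn ?subnn //; lia.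
have nx := size_subst_word phi x; have nz := size_subst_word phi z.
have pa : subst_word phi u =
    subst_word phi x ++ phi a ++ subst_word phi z.
  by rewrite ue -cat1s !subst_word_cat /subst_word /= cats0.
have -> : collar_block phi u =
    collars (center u) n (subst_word phi x) (phi a) (subst_word phi z).
  rewrite /collar_block /collars {2}ca; apply: eq_mkseq => i.
  by rewrite pa ue take_cat xn ltnn subnn take0 cats0.
by apply: (@collars_eq _ _ _ _ _ _ _ _ [::] [::] [::] [::]); rewrite -?xn -?zn ?xn ?zn //; lia.
Qed.

Lemma subst_collars phi n d x y z : (n <= size x)%N -> (n <= size z)%N ->
  subst_word (collared_ext phi n) (collars d n x y z) =
  collars d n (subst_word phi x) (subst_word phi y) (subst_word phi z).
Proof.
elim: y x => // a y IH x nx nz; rewrite -[a :: y]cat1s collars_cat !subst_word_cat.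
rewrite collars_cat {}IH ?size_cat; [|lia|by []].
rewrite !subst_word_cat; congr (_ ++ _).
set t := y ++ z; have nt : (n <= size t)%N by rewrite size_cat; lia.
rewrite -subst_word_cat -/t /subst_word /= !cats0 /= -!/(subst_word _ _).
rewrite (@collar_blockE _ _ d _ (drop (size x - n) x) a (take n t)); last 2 first.
- apply: (@eq_from_nth _ d) => [|j]; rewrite size_tuple.
    by rewrite size_cat size_drop /= size_takel //; lia.
  move=> jn; rewrite -[X in nth _ _ X = _]/(nat_of_ord (Ordinal jn)) -tnth_nth tnth_mktuple /=.
  rewrite !nth_cat size_drop nth_drop.
  have -> : (size x - (size x - n) = n)%N by lia.
  have [jn'|jn'] := ltnP j n.
    by rewrite ifT; [congr nth|]; lia.
  rewrite ifF; last by lia.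
  have -> : (size x + 0 - n + j - size x = j - n)%N by lia.
  by case e: (j - n)%N => [|l] //=; rewrite nth_take //; lia.
- by rewrite size_drop; lia.
have sx := size_subst_word phi (drop (size x - n) x).
have st := size_subst_word phi (take n t).
move: sx st; rewrite size_drop size_takel // => sx st.
have := size_subst_word phi x; have := size_subst_word phi t => tt' xx'.
apply: (@collars_eq _ _ _ _ _ _ _ _ (subst_word phi (take (size x - n) x))
  (subst_word phi (drop n t)) [::] [::]); rewrite ?cats0 /=; try lia.
  rewrite !catA -subst_word_cat cat_take_drop -!catA.
  by rewrite -[subst_word phi (take n t) ++ _]subst_word_cat cat_take_drop.
by rewrite -size_cat -subst_word_cat cat_take_drop.
Qed.

Lemma iter_subst_collars phi n d k x y z :
  (n <= size x)%N -> (n <= size z)%N ->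
  iter k (subst_word (collared_ext phi n)) (collars d n x y z) =
  collars d n (iter k (subst_word phi) x) (iter k (subst_word phi) y)
              (iter k (subst_word phi) z).
Proof.
move=> nx nz; elim: k => //= k ->; rewrite subst_collars //.
  by apply: leq_trans nx _; apply: size_iter_subst.
by apply: leq_trans nz _; apply: size_iter_subst.
Qed.

Lemma collar_window n d w i m :
  mkseq (fun j => collar_tuple n w (i + j%:Z)) m =
  collars d n (window w (i - n%:Z) n) (window w i m) (window w (i + m%:Z) n).
Proof.
rewrite /collars !size_window; apply: (@eq_from_nth _ [tuple d | _ < n.*2.+1]).
  by rewrite !size_mkseq.
rewrite size_mkseq => j jm; rewrite !nth_mkseq //.
apply: eq_from_tnth => l; rewrite !tnth_mktuple.
have ln := ltn_ord l.
have -> : window w (i - n%:Z) n ++ window w i m ++ window w (i + m%:Z) n =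
    window w (i - n%:Z) (n + (m + n)).
  by rewrite !window_cat !subrK.
by rewrite nth_window; [congr w|]; lia.
Qed.

Lemma collars_infix n d x y z y' p q : (n <= size x)%N -> (n <= size z)%N ->
  (n <= size p)%N -> (n <= size q)%N ->
  y' = p ++ y ++ q -> infix (collars d n p y q) (collars d n x y' z).
Proof.
move=> nx nz np nq ->; rewrite !collars_cat.
rewrite (_ : collars d n p y q = collars d n (x ++ p) y (q ++ z)).
  exact: infix_infix.
apply: (@collars_eq _ _ _ _ _ _ _ _ x z [::] [::]); rewrite ?size_cat ?cats0 //; try lia.
by rewrite /= !catA.
Qed.

Lemma seed_exists phi b n a : exists u : n.*2.+1.-tuple A,
  collared_seed phi b u /\ exists x z,
    [/\ tval u = x ++ a :: z, size x = n & size z = n].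
Proof.
have [[w Xw [i /= ai]]|la] := pselect (legal phi [:: a]).
  exists (collar_tuple n w i); split; first by left; apply: legal_collar_tuple.
  exists (window w (i - n%:Z) n), (window w (i + 1) n).
  rewrite !size_window; split=> //; rewrite collar_tupleE -addnn -addnS.
  rewrite window_cat subrK -[n.+1]add1n window_cat.
  by rewrite -[a :: _]cat1s ai.
have sz : size (nseq n b ++ a :: nseq n b) == n.*2.+1.
  by rewrite size_cat /= !size_nseq; lia.
exists (Tuple sz); split; first by right; exists a.
by exists (nseq n b), (nseq n b); rewrite !size_nseq.
Qed.

Lemma collars1 n d (u : n.*2.+1.-tuple A) x a z :
  tval u = x ++ a :: z -> size x = n -> collars d n x [:: a] z = [:: u].
Proof.
move=> ue xn; rewrite /collars /=; congr [:: _]; apply: eq_from_tnth => j.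
by rewrite tnth_mktuple (tnth_nth d) ue; congr nth; lia.
Qed.

End Collaring.

Section CollarMap.
Context {A : finType} (phi : substitution A) (b : A) (n : nat).
Implicit Types w : subshift phi.

Definition sub_shift k w : subshift phi :=
  exist _ (shift k (val w)) (mem_set (subshift_shift k (set_mem (valP w)))).

Definition sub_subst w : subshift phi :=
  exist _ (subst_seq phi (val w)) (mem_set (subshift_subst (set_mem (valP w)))).

Definition collar_fun w (i : int) : collar_alphabet phi b n :=
  exist _ (collar_tuple n (val w) i)
    (collared_letter_tuple b n i (set_mem (valP w))).

Lemma map_val_infix (s t : seq (collar_alphabet phi b n)) :
  infix (map val s) (map val t) -> infix s t.
Proof.
move=> /infixP[p [q e]].
have /(congr1 (take (size p))) := e.
have /(congr1 (drop (size p))) := e.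
rewrite drop_size_cat // take_size_cat // -map_take -map_drop => ed ep.
have /(congr1 (take (size s))) := ed; have /(congr1 (drop (size s))) := ed.
rewrite take_size_cat ?size_map // -map_take => _ /(inj_map val_inj) <-.
by apply: infix_trans (infix_take _ _) (infix_drop _ _).
Qed.

Lemma map_val_collar_window w i m :
  map val (window (collar_fun w) i m) =
  collars b n (window (val w) (i - n%:Z) n) (window (val w) i m)
    (window (val w) (i + m%:Z) n).
Proof. by rewrite -collar_window /window /mkseq -map_comp. Qed.

Lemma collar_fun_subshift w : subshift (collar_subst phi b n) (collar_fun w).
Proof.
move=> i m.
have [a [k ak]] := set_mem (valP w) (i - n%:Z) (n + (m + n))%N.
have [u [su [x [z [ue xn zn]]]]] := seed_exists phi b n a.
have cu : `[< collared_letter phi b u >].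
  by apply/asboolP; exists u, 0%N; rewrite /= mem_head.
exists (exist _ u cu), k; apply: map_val_infix.
rewrite map_iter_collar_subst map_val_collar_window /= -(collars1 b ue xn).
rewrite iter_subst_collars ?xn ?zn //.
have kx := size_iter_subst phi k x; have kz := size_iter_subst phi k z.
have /infixP[p [q ->]] := ak.
rewrite !window_cat subrK.
set W1 := window _ _ _; set W2 := window _ _ _; set W3 := window _ _ _.
apply: infix_trans (_ : infix _ (collars b n (p ++ W1) W2 (W3 ++ q))) _.
  rewrite (@collars_eq _ n b b W1 W2 W3 (p ++ W1) (W3 ++ q) p q [::] [::])
    ?infix_refl ?size_cat ?size_window ?cats0 //; try lia.
  by rewrite /= !catA.
apply: collars_infix; rewrite ?size_cat ?size_window; try lia.
by rewrite !catA.
Qed.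

Definition collar_map w : subshift (collar_subst phi b n) :=
  exist _ (collar_fun w) (mem_set (collar_fun_subshift w)).

Lemma collar_map_shift k w :
  val (collar_map (sub_shift k w)) = shift k (val (collar_map w)).
Proof.
by apply/funext => i; apply: val_inj; rewrite /= collar_tuple_shift.
Qed.

Lemma size_collar_subst (u : collar_alphabet phi b n) :
  size (collar_subst phi b n u) = size (phi (center (val u))).
Proof. by rewrite -(size_map val) collar_subst_letterE size_mkseq. Qed.

Lemma collar_map_subst w :
  val (collar_map (sub_subst w)) = subst_seq (collar_subst phi b n) (val (collar_map w)).
Proof.
apply/funext => i; apply: val_inj => /=; symmetry.
have [N NE] : {N | N = (absz i).+1} by eexists.
pose cw := collar_fun w; pose v := val w.
pose P := subst_word (collar_subst phi b n) (window cw (- N%:Z) N).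
pose Q := subst_word (collar_subst phi b n) (window cw (- N%:Z + N%:Z) N).
pose L := subst_word (collar_subst phi b n) (window cw (- N%:Z) (N + N)).
have nP : (N <= size P)%N.
  by apply: leq_trans (size_subst_word _ _); rewrite size_window.
have nQ : (N <= size Q)%N.
  by apply: leq_trans (size_subst_word _ _); rewrite size_window.
have eL : L = P ++ Q by rewrite /L window_cat subst_word_cat.
have [j je] : {j : nat | j%:Z = i + (size P)%:Z}.
  by exists (absz (i + (size P)%:Z)); lia.
have jL : (j < size L)%N by rewrite eL size_cat; lia.
have -> : i = j%:Z - (size P)%:Z by lia.
rewrite (@subst_seqE _ _ _ (collar_fun w 0) N N) //.
rewrite -(nth_map _ (val (collar_fun w 0)) val) //.
have vL m : map val (subst_word (collar_subst phi b n) (window cw (- N%:Z) m)) =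
  collars b n (subst_word phi (window v (- N%:Z - n%:Z) n))
   (subst_word phi (window v (- N%:Z) m)) (subst_word phi (window v (- N%:Z + m%:Z) n)).
  by rewrite map_collar_subst map_val_collar_window subst_collars ?size_window.
have sz m : size (subst_word (collar_subst phi b n) (window cw (- N%:Z) m)) =
    size (subst_word phi (window v (- N%:Z) m)).
  by rewrite -(size_map val) vL size_mkseq.
rewrite vL nth_mkseq; last by rewrite -sz.
apply: eq_from_tnth => l; rewrite !tnth_mktuple -!subst_word_cat.
have ln := ltn_ord l.
have -> : window v (- N%:Z - n%:Z) n ++ window v (- N%:Z) (N + N) ++
          window v (- N%:Z + (N + N)%:Z) n =
          window v (- (N + n)%:Z) ((N + n) + (N + n)).
  have -> : (N + n + (N + n) = n + (N + N + n))%N by lia.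
  rewrite !window_cat; congr (window _ _ _ ++ (window _ _ _ ++ window _ _ _) ++ window _ _ _); lia.
set F := subst_word phi (window v (- N%:Z - n%:Z) n).
have nF : (n <= size F)%N.
  by apply: leq_trans (size_subst_word _ _); rewrite size_window.
have eP : subst_word phi (window v (- (N + n)%:Z) (N + n)) =
    F ++ subst_word phi (window v (- N%:Z) N).
  rewrite addnC window_cat subst_word_cat.
  by congr (subst_word _ (window _ _ _) ++ subst_word _ (window _ _ _)); lia.
have sP : size P = size (subst_word phi (window v (- N%:Z) N)) by rewrite sz.
rewrite -(@subst_seqE _ phi v b (N + n) (N + n)).
  by congr (subst_seq _ _); rewrite eP size_cat -sP; lia.
have -> : (N + n + (N + n) = n + (N + N + n))%N by lia.
rewrite !window_cat !subst_word_cat !size_cat.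
have -> : subst_word phi (window v (- (N + n)%:Z) n) = F.
  by congr (subst_word _ (window _ _ _)); lia.
have := sz (N + N)%N; rewrite -/L => sL.
have -> : (- (N + n)%:Z + n%:Z) = - N%:Z by lia.
move: jL; rewrite sL window_cat subst_word_cat size_cat => jL.
have sW := size_subst_word phi (window v (- N%:Z + (N + N)%:Z) n).
move: sW; rewrite size_window; set S3 := size _; move=> sW.
lia.
Qed.

End CollarMap.

Section TilingSpace.
Context (R : realType) {A : finType} (phi : substitution A).

Definition unit_interval : set R := `[0, 1]%classic.

Definition cylinder : topologicalType :=
  (set_type (subshift phi) * set_type unit_interval)%type.

Definition glue (x y : cylinder) : Prop :=
  [/\ val x.2 = 1, val y.2 = 0 & val y.1 = shift 1 (val x.1)].

Definition tiling_rel (x y : cylinder) : bool :=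
  `[< clos_refl_sym_trans cylinder glue x y >].

Lemma tiling_rel_refl : reflexive tiling_rel.
Proof. by move=> x; apply/asboolP; apply: rst_refl. Qed.

Lemma tiling_rel_sym : symmetric tiling_rel.
Proof. by move=> x y; apply: asbool_equiv_eq; split; apply: rst_sym. Qed.

Lemma tiling_rel_trans : transitive tiling_rel.
Proof.
by move=> y x z /asboolP xy /asboolP yz; apply/asboolP; apply: rst_trans xy yz.
Qed.

Definition tiling_equiv :=
  EquivRel tiling_rel tiling_rel_refl tiling_rel_sym tiling_rel_trans.

Definition tiling_space : topologicalType :=
  quotient_topology {eq_quot tiling_equiv}.

Definition tile (x : cylinder) : tiling_space :=
  \pi_({eq_quot tiling_equiv}) x.

Lemma tile_eq x y : tile x = tile y <-> clos_refl_sym_trans cylinder glue x y.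
Proof.
split=> [/eqmodP/asboolP // | xy]; by apply/eqmodP/asboolP.
Qed.

Definition tile_repr (x : tiling_space) : cylinder :=
  repr (x : {eq_quot tiling_equiv}).

Lemma tile_reprK : cancel tile_repr tile.
Proof. by move=> x; rewrite /tile /tile_repr reprK. Qed.

Lemma unit_interval0 : (0 : R) \in unit_interval.
Proof. by rewrite inE /unit_interval /= in_itv /= lexx ler01. Qed.

Lemma tile_surj x : exists w t, val t < 1 /\ x = tile (w, t).
Proof.
case E: (tile_repr x) => [w t].
have /set_mem := valP t; rewrite /unit_interval /= in_itv /= => /andP[t0 t1].
have [e|n1] := eqVneq (val t) 1; last first.
  by exists w, t; rewrite lt_neqAle n1 t1 -E tile_reprK.
exists (sub_shift 1 w), (exist (fun r => r \in unit_interval) 0 unit_interval0); split; first exact: ltr01.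
by rewrite -(tile_reprK x) E; apply/tile_eq; apply: rst_step.
Qed.

Lemma fracpart_unit (s : R) : s - (Num.floor s)%:~R \in unit_interval.
Proof.
rewrite inE /unit_interval /= in_itv /= subr_ge0 floor_le /=.
by rewrite lerBlDl -intrD1 ltW // floorD1_gt.
Qed.

Definition fracpart (s : R) : unit_interval :=
  exist (fun r => r \in unit_interval) _ (fracpart_unit s).

(* The formula for phi(w,t) makes sense for t = 1 as well, and there it agrees
   with the value at (sigma(w),0), see cylinder_map_glue. *)
Definition cylinder_map (x : cylinder) : cylinder :=
  let s := (size (phi (val x.1 0)))%:R * val x.2 in
  (sub_shift (Num.floor s) (sub_subst x.1), fracpart s).

Definition tiling_map (x : tiling_space) : tiling_space :=
  tile (cylinder_map (tile_repr x)).

Lemma cylinder_map_glue x y : glue x y -> cylinder_map x = cylinder_map y.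
Proof.
case: x y => [w t] [w' t'] [/= t1 t0 ww'].
have fl m : Num.floor (m%:R : R) = m%:Z by rewrite pmulrn intrKfloor.
rewrite /cylinder_map /=; congr (_, _); apply: val_inj => /=.
  rewrite t1 t0 mulr1 mulr0 floor0 fl ww'.
  by apply/funext => i; rewrite -subst_seq_shift /shift addr0.
by rewrite t1 t0 mulr1 mulr0 floor0 fl subrr subr0.
Qed.

Lemma tiling_mapE x : tiling_map (tile x) = tile (cylinder_map x).
Proof.
have /tile_eq := tile_reprK (tile x); rewrite /tiling_map; move: (tile_repr (tile x)) => y.
by elim=> [u v /cylinder_map_glue ->|//|u v _ ->//|u v z _ -> _ ->].
Qed.

Definition recognisable : Prop := injective tiling_map.

(* Points of the tiling space are written (w,t) with 0 <= t < 1. *)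
Definition ap_step (x y : tiling_space) : Prop :=
  exists (w w' : subshift phi) (t : unit_interval),
    [/\ val t < 1, x = tile (w, t), y = tile (w', t) &
        (0 < val t /\ val w 0 = val w' 0) \/
        (val t = 0 /\ (val w (-1) = val w' (-1) \/ val w 0 = val w' 0))].

Definition ap_rel (x y : tiling_space) : bool :=
  `[< clos_trans tiling_space ap_step x y >].

Lemma ap_rel_refl : reflexive ap_rel.
Proof.
move=> x; apply/asboolP; apply: t_step.
have [w [t [t1 ->]]] := tile_surj x; exists w, w, t; split=> //.
have /set_mem := valP t; rewrite /unit_interval /= in_itv /= => /andP[t0 _].
by move: t0; rewrite le_eqVlt => /predU1P[<-|t0]; [right; split=> //; right|left].
Qed.

Lemma ap_step_sym x y : ap_step x y -> ap_step y x.
Proof.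
move=> [w [w' [t [t1 -> -> h]]]]; exists w', w, t; split=> //.
by case: h => [[t0 ->]|[t0 [->|->]]]; [left|right; split=> //; left|right; split=> //; right].
Qed.

Lemma ap_rel_sym : symmetric ap_rel.
Proof.
have S x y : clos_trans tiling_space ap_step x y -> clos_trans tiling_space ap_step y x.
  elim=> [u v /ap_step_sym|u v z _ vu _ zv]; first exact: t_step.
  exact: t_trans zv vu.
by move=> x y; apply: asbool_equiv_eq; split; apply: S.
Qed.

Lemma ap_rel_trans : transitive ap_rel.
Proof.
by move=> y x z /asboolP xy /asboolP yz; apply/asboolP; apply: t_trans xy yz.
Qed.

Definition ap_equiv := EquivRel ap_rel ap_rel_refl ap_rel_sym ap_rel_trans.

Definition ap_complex : topologicalType := quotient_topology {eq_quot ap_equiv}.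

Definition ap_proj (x : tiling_space) : ap_complex := \pi_({eq_quot ap_equiv}) x.

Lemma ap_proj_eq x y :
  ap_proj x = ap_proj y <-> clos_trans tiling_space ap_step x y.
Proof.
split=> [/eqmodP/asboolP // | xy]; by apply/eqmodP/asboolP.
Qed.

Definition ap_map (x : ap_complex) : ap_complex :=
  ap_proj (tiling_map (repr (x : {eq_quot ap_equiv}))).

Lemma ap_projK (x : ap_complex) : ap_proj (repr (x : {eq_quot ap_equiv})) = x.
Proof. by rewrite /ap_proj reprK. Qed.

Lemma subst_seq_nth w k : (k < size (phi (w 0%R)))%N ->
  subst_seq phi w k%:Z = nth (w 0) (phi (w 0)) k.
Proof.
move=> kw; rewrite (@subst_seq_pos _ _ _ (w 0) _ 1);
  by rewrite /subst_word /window /mkseq /= addr0 cats0.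
Qed.

Lemma subst_seq_last w :
  subst_seq phi w (-1) = last (w (-1)) (phi (w (-1))).
Proof.
have e : subst_word phi (window w (- 1%:Z) 1) = phi (w (-1)).
  by rewrite /subst_word /window /mkseq /= addr0 cats0.
rewrite (@subst_seq_neg _ _ _ (w (-1)) 0 1) e; first by rewrite /= subn1 nth_last.
by rewrite lt0n size_eq0 subst_letter_neq0.
Qed.

Lemma tiling_map_step x y : ap_step x y -> ap_step (tiling_map x) (tiling_map y).
Proof.
move=> [w [w' [t [t1 -> -> h]]]]; rewrite !tiling_mapE.
have /set_mem := valP t; rewrite /unit_interval /= in_itv /= => /andP[t0 _].
have fr (s : R) : 0 <= s - (Num.floor s)%:~R < 1.
  by rewrite subr_ge0 floor_le /= ltrBlDl -intrD1 floorD1_gt.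
case: h => [[tp ww]|[tz ww]].
  set s := (size (phi (val w 0)))%:R * val t.
  exists (sub_shift (Num.floor s) (sub_subst w)),
    (sub_shift (Num.floor s) (sub_subst w')), (fracpart s).
  have /andP[f0 f1] := fr s.
  have s0 : 0 <= s by rewrite mulr_ge0.
  have [k kE] : exists k : nat, Num.floor s = k%:Z.
    have fs : 0 <= Num.floor s by rewrite floor_ge0.
    by exists (absz (Num.floor s)); rewrite gez0_abs.
  have same : val (sub_shift (Num.floor s) (sub_subst w)) 0 =
              val (sub_shift (Num.floor s) (sub_subst w')) 0.
    have kw : (k < size (phi (val w 0)))%N.
      rewrite -(ltr_nat R); apply: le_lt_trans (_ : s < _).
        by have := floor_le s; rewrite kE.
      rewrite /s gtr_pMr // ltr0n lt0n size_eq0; exact: subst_letter_neq0.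
    rewrite /= /shift add0r kE !subst_seq_nth -?ww // .
  split=> //=.
  - by rewrite /cylinder_map /= -ww.
  - move: f0; rewrite le_eqVlt => /predU1P[<-|f0]; last by left.
    by right; split=> //; right.
exists (sub_subst w), (sub_subst w'), t; split=> //.
- congr tile; rewrite /cylinder_map /=; congr (_, _); apply: val_inj => /=;
    rewrite tz mulr0 floor0 ?subr0 //.
  by apply/funext => i; rewrite /shift addr0.
- congr tile; rewrite /cylinder_map /=; congr (_, _); apply: val_inj => /=;
    rewrite tz mulr0 floor0 ?subr0 //.
  by apply/funext => i; rewrite /shift addr0.
right; split=> //; case: ww => ww; [left|right].
  rewrite -[LHS]/(subst_seq phi (val w) (-1)).
  rewrite -[RHS]/(subst_seq phi (val w') (-1)).
  by rewrite !subst_seq_last -ww.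
have p : (0 < size (phi (val w 0)))%N.
  by rewrite lt0n size_eq0 subst_letter_neq0.
rewrite -[LHS]/(subst_seq phi (val w) 0%:Z).
rewrite -[RHS]/(subst_seq phi (val w') 0%:Z).
by rewrite !subst_seq_nth -?ww.
Qed.

Lemma ap_mapE x : ap_map (ap_proj x) = ap_proj (tiling_map x).
Proof.
have /ap_proj_eq := ap_projK (ap_proj x); rewrite /ap_map; move: (repr _) => y.
elim=> [u v uv|u v z _ -> _ ->//]; apply/ap_proj_eq; apply: t_step.
exact: tiling_map_step.
Qed.

End TilingSpace.

Section CollaredComplex.
Context (R : realType) {A : finType} (phi : substitution A) (b : A) (n : nat).

Definition collar_cylinder (x : cylinder R phi) :
    cylinder R (collar_subst phi b n) := (collar_map b n x.1, x.2).

Definition collar_tiling (x : tiling_space R phi) :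
    tiling_space R (collar_subst phi b n) :=
  tile (collar_cylinder (tile_repr x)).

Lemma collar_tilingE x : collar_tiling (tile x) = tile (collar_cylinder x).
Proof.
have /tile_eq := tile_reprK (tile x); rewrite /collar_tiling; move: (tile_repr (tile x)) => y.
elim=> [[w t] [w' t'] [/= t1 t0 ww']|//|u v _ ->//|u v z _ -> _ -> //].
apply/tile_eq; apply: rst_step; split=> //=.
have -> : w' = sub_shift 1 w by apply: val_inj.
exact: collar_map_shift.
Qed.

Definition collared_complex : topologicalType :=
  ap_complex R (collar_subst phi b n).

Definition collared_proj (x : tiling_space R phi) : collared_complex :=
  ap_proj (collar_tiling x).

Definition collared_map : collared_complex -> collared_complex :=
  @ap_map R _ (collar_subst phi b n).

Lemma collar_tiling_map x :
  collar_tiling (tiling_map x) = tiling_map (collar_tiling x).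
Proof.
rewrite -[x]tile_reprK collar_tilingE !tiling_mapE collar_tilingE.
case: (tile_repr x) => w t; congr tile.
have sz : size (collar_subst phi b n (val (collar_map b n w) 0)) =
          size (phi (val w 0)).
  by rewrite size_collar_subst /= center_collar_tuple.
have e k : collar_map b n (sub_shift k (sub_subst w)) =
           sub_shift k (sub_subst (collar_map b n w)).
  by apply: val_inj; rewrite collar_map_shift collar_map_subst.
pose s : R := (size (phi (val w 0)))%:R * val t.
rewrite -[LHS]/(collar_map b n (sub_shift (Num.floor s) (sub_subst w)), fracpart s).
by rewrite e /s -sz.
Qed.

Lemma collared_map_proj :
  collared_map \o collared_proj = collared_proj \o @tiling_map R A phi.
Proof.
apply/funext => x /=.
by rewrite /collared_map /collared_proj ap_mapE collar_tiling_map.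
Qed.

End CollaredComplex.

Definition inverse_limit (T : topologicalType) (f : T -> T) : set {ptws nat -> T} :=
  [set x | forall i, f (x i.+1) = x i].

Definition homeomorphism (S T : topologicalType) (f : S -> T) : Prop :=
  continuous f /\
  exists g : T -> S, [/\ continuous g, cancel f g & cancel g f].

(* If the map induced by phi is bijective, this is its inverse. *)
Definition tiling_map_inv (R : realType) (A : finType) (phi : substitution A) :
    tiling_space R phi -> tiling_space R phi :=
  'pinv_id setT (@tiling_map R A phi).

Definition limit_seq (R : realType) (A : finType) (phi : substitution A)
    (b : A) (n : nat) (x : tiling_space R phi) :
    {ptws nat -> collared_complex R phi b n} :=
  fun i => collared_proj b n (iter i (@tiling_map_inv R A phi) x).

(* Main.v *)
From Pilot Require Import Defs.
From Stdlib Require Import Relation_Operators.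
From mathcomp Require Import all_boot all_order all_algebra.
From mathcomp Require Import all_classical all_reals all_analysis.
From mathcomp Require Import zify ring lra.

Set Implicit Arguments.
Unset Strict Implicit.
Unset Printing Implicit Defensive.

Import Order.TTheory GRing.Theory Num.Theory.
Import numFieldNormedType.Exports.
Import Pilot.Defs.

Local Open Scope classical_set_scope.
Local Open Scope ring_scope.
Local Open Scope quotient_scope.

(** The map sends [x] to the projections of its backward orbit under the map
    [phi] of the tiling space [Omega], and the argument is the usual one for a
    continuous bijection from a compact space to a Hausdorff space.

    [Omega] is compact and Hausdorff ([compact_tiling_space],
    [hausdorff_tiling_space]); the map [phi] is continuous and onto, the latter
    because by compactness every point of the subshift is a shift of a
    substituted one ([subst_seq_surj]).  So recognisability makes it a
    homeomorphism, and the map to the inverse limit is continuous.  The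
    Anderson-Putnam complexes are Hausdorff ([hausdorff_ap_complex]), hence so is
    the inverse limit.  Hausdorffness is always obtained from continuous
    real-valued functions that separate points, of the form
    [c0(t) g(w) + c1(t) g(sigma w)] with [g] locally constant ([blend_lift]).

    Surjectivity: for a point [z] of the inverse limit, the closed sets of those
    [x] whose [i]-th preimage projects to [z_i] are non-empty and nested
    ([limit_seq_surj]).  That they are non-empty uses that the projection to the
    collared complex is onto, i.e. that every point of the collared subshift is
    the collaring of a point of the original one ([collar_map_surj]).

    Injectivity is where tameness and the radius [N] enter.  If two points have
    the same image, then for every [k] their [k]-th preimages lie at the same
    height and have the same letters within distance about [N] of the origin
    ([collared_proj_agree]).  A legal word of length [N] is too long to be
    bounded, and there are finitely many of them, so their [k]-fold images are
    uniformly long ([legal_growth]).  Applying [phi] [k] times, the two points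
    agree on arbitrarily long windows on both sides of the origin
    ([limit_seq_inj]). *)

(** * Compactness, separation and continuity *)

Section GeneralTopology.

Lemma hausdorff_separating (R : realFieldType) (T : topologicalType) :
  (forall x y : T, (forall f : T -> R, continuous f -> f x = f y) -> x = y) ->
  hausdorff_space T.
Proof.
move=> sep x y xy; apply: sep => f cf; apply: Rhausdorff => U V fxU fyV.
have [z [zU zV]] := xy _ _ (cf x _ fxU) (cf y _ fyV).
by exists (f z).
Qed.

Lemma hausdorff_inj (S T : topologicalType) (f : S -> T) :
  continuous f -> injective f -> hausdorff_space T -> hausdorff_space S.
Proof.
move=> cf injf hT x y xy; apply: injf; apply: hT => U V fxU fyV.
have [z [zU zV]] := xy _ _ (cf x _ fxU) (cf y _ fyV).
by exists (f z).
Qed.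

Lemma continuous_compact_inverse (S T : topologicalType) (f : S -> T) (g : T -> S) :
  compact [set: S] -> hausdorff_space T -> continuous f ->
  cancel f g -> cancel g f -> continuous g.
Proof.
move=> cS hT cf fg gf; apply/continuous_closedP => C clC.
have -> : g @^-1` C = f @` C.
  apply/seteqP; split=> [y Cgy|_ [x Cx <-]]; first by exists (g y).
  by rewrite /preimage /= fg.
apply: compact_closed => //; apply: continuous_compact.
  by apply: continuous_subspaceT.
exact: subclosed_compact clC cS _.
Qed.

(** Cantor's intersection theorem: a cluster point of the filter generated by the
    sets belongs to all of them. *)
Lemma compact_nested (T : topologicalType) (K : nat -> set T) :
  compact [set: T] -> (forall i, closed (K i)) -> (forall i, K i !=set0) ->
  (forall i, K i.+1 `<=` K i) -> exists x, forall i, K i x.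
Proof.
move=> cT clK neK decK.
have mono i j : (i <= j)%N -> K j `<=` K i.
  by move=> /subnK <-; elim: (j - i)%N => // d IH; apply: subset_trans IH; apply: decK.
have PF : ProperFilter (filter_from [set: nat] K).
  apply: filter_from_proper => [|i _]; last exact: neK.
  apply: filter_from_filter; first by exists 0%N.
  move=> i j _ _; exists (maxn i j) => // x Kx.
  by split; apply: mono Kx; rewrite ?leq_maxl ?leq_maxr.
have [x [_ xK]] := cT _ PF (filterT (F := filter_from [set: nat] K)).
by exists x => i; apply: clK => U xU; apply: xK => //; exists i.
Qed.

Lemma compact_set_type (T : topologicalType) (A : set T) :
  compact A -> compact [set: set_type A].
Proof.
move=> cA F PF _.
have FA : ((fun z : set_type A => val z) @ F) A.
  have FT : F [set: set_type A] by exact: filterT.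
  by apply: (@filterS _ F _ _ _ _ FT) => z _ /=; have /set_mem := valP z.
have [x [Ax xF]] := cA _ _ FA.
exists (exist _ x (mem_set Ax)); split=> // U V FU [W [[D oD <-] /= Dx DV]].
have FU' : ((fun z : set_type A => val z) @ F) ((fun z : set_type A => val z) @` U).
  by apply: (@filterS _ F _ _ _ _ FU) => z Uz; exists z.
have [_ [[z Uz <-] Dz]] := xF _ _ FU' (open_nbhs_nbhs (conj oD Dx)).
by exists z; split=> //; apply: DV.
Qed.

Lemma continuous_locally_cst (S T : topologicalType) (f : S -> T) :
  (forall x, \forall y \near x, f y = f x) -> continuous f.
Proof. by move=> fx x; apply: cvg_near_cst; apply: fx. Qed.

Lemma continuous_set_type (S T : topologicalType) (A : set T) (f : S -> set_type A) :
  continuous (fun x => val (f x)) -> continuous f.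
Proof.
move=> cf x U [W [[D oD <-] /= Dx DU]].
have Dnear := cf x _ (open_nbhs_nbhs (conj oD Dx)).
by apply: (@filterS _ (nbhs x) _ _ _ _ Dnear) => y /DU.
Qed.

Lemma continuous_ptws (S : topologicalType) (I : eqType) (T : I -> topologicalType)
    (f : S -> prod_topology T) :
  (forall i, continuous (fun x => f x i)) -> continuous f.
Proof.
move=> cf x; apply/cvg_sup => i U [W [[D oD <-] /= Dx DU]].
have Dnear := cf i x _ (open_nbhs_nbhs (conj oD Dx)).
by apply: (@filterS _ (nbhs x) _ _ _ _ Dnear) => y /DU.
Qed.

Lemma continuous_pair (S T U : topologicalType) (f : S -> T) (g : S -> U) :
  continuous f -> continuous g -> continuous (fun x => (f x, g x)).
Proof. by move=> cf cg x; apply: cvg_pair; [apply: cf | apply: cg]. Qed.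

Lemma continuous_compose (S T U : topologicalType) (f : S -> T) (g : T -> U) :
  continuous f -> continuous g -> continuous (fun x => g (f x)).
Proof. by move=> cf cg x; apply: continuous_comp; [apply: cf | apply: cg]. Qed.

End GeneralTopology.

(** * Windows of substituted sequences *)

Section Words.
Context {A : finType}.
Implicit Types (phi : substitution A) (u v : seq A) (w : int -> A).

(** The block structure is anchored at the origin, so the image of a window that
    starts at [- n] starts at minus the length of the image of its left half. *)
Lemma window_subst_seq phi w n m :
  let P := subst_word phi (window w (- n%:Z) n) in
  let L := subst_word phi (window w (- n%:Z) (n + m)) in
  window (subst_seq phi w) (- (size P)%:Z) (size L) = L.
Proof.
move=> P L; apply: (@eq_from_nth _ (w 0)) => [|j]; rewrite size_window // => jL.
by rewrite nth_window // addrC (@subst_seqE _ _ _ (w 0) n m).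
Qed.

Lemma window_iter_subst phi w k n m :
  let P := iter k (subst_word phi) (window w (- n%:Z) n) in
  let L := iter k (subst_word phi) (window w (- n%:Z) (n + m)) in
  window (iter k (subst_seq phi) w) (- (size P)%:Z) (size L) = L.
Proof.
have le i p : (size (iter i (subst_word phi) (window w (- n%:Z) n)) <=
    size (iter i (subst_word phi) (window w (- n%:Z) (n + p))))%N.
  by rewrite window_cat iter_subst_cat size_cat leq_addr.
rewrite /=; elim: k m => [|k IH] m; first by rewrite /= !size_window.
have /= := window_subst_seq phi (iter k (subst_seq phi) w)
  (size (iter k (subst_word phi) (window w (- n%:Z) n)))
  (size (iter k (subst_word phi) (window w (- n%:Z) (n + m))) -
   size (iter k (subst_word phi) (window w (- n%:Z) n))).
rewrite subnKC // IH.
by have := IH 0%N; rewrite addn0 => ->.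
Qed.

(** Letters of a window determine the letters of the iterated image as far as the
    images of the two halves of the window reach. *)
Lemma iter_subst_agree phi w w' k n m i :
  window w (- n%:Z) (n + m) = window w' (- n%:Z) (n + m) ->
  - (size (iter k (subst_word phi) (window w (- n%:Z) n)))%:Z <= i ->
  i < (size (iter k (subst_word phi) (window w 0 m)))%:Z ->
  iter k (subst_seq phi) w i = iter k (subst_seq phi) w' i.
Proof.
move=> ww' iP iS.
have wwn : window w (- n%:Z) n = window w' (- n%:Z) n.
  have := congr1 (take n) ww'; rewrite !window_cat !take_size_cat ?size_window //.
have := window_iter_subst phi w' k n m; rewrite /= -ww' -wwn.
have := window_iter_subst phi w k n m; rewrite /=.
set P := iter k _ _ in iP *; set L := iter k (subst_word phi) (window w (- n%:Z) (n + m)).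
have sL : size L = (size P + size (iter k (subst_word phi) (window w 0 m)))%N.
  by rewrite /L window_cat addNr iter_subst_cat size_cat.
have ei : i = - (size P)%:Z + (absz (i + (size P)%:Z))%:Z by lia.
have iL : (absz (i + (size P)%:Z)%R < size L)%N by lia.
by move=> e e'; rewrite ei -!(nth_window (w 0) _ _ iL) e e'.
Qed.

Lemma subst_seq_agree phi w w' n i :
  window w (- n%:Z) (n + n) = window w' (- n%:Z) (n + n) ->
  - n%:Z <= i -> i < n%:Z -> subst_seq phi w i = subst_seq phi w' i.
Proof.
move=> ww' ni iN; apply: (@iter_subst_agree _ _ _ 1 n n) => //=.
  have := size_subst_word phi (window w (- n%:Z) n).
  by rewrite size_window; lia.
have := size_subst_word phi (window w 0 n).
by rewrite size_window; lia.
Qed.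

Lemma shift_shift (k l : int) w : shift k (shift l w) = shift (k + l) w.
Proof. by apply/funext => i; rewrite /shift addrA. Qed.

Lemma shift_zero w : shift 0 w = w.
Proof. by apply/funext => i; rewrite /shift addr0. Qed.

(** Moving the origin by [k] letters moves the origin of the image by the length
    of the image of these letters. *)
Lemma subst_seq_shiftn phi w k :
  subst_seq phi (shift k%:Z w) =
  shift (size (subst_word phi (window w 0 k)))%:Z (subst_seq phi w).
Proof.
elim: k => [|k IH]; first by rewrite !shift_zero.
have -> : shift k.+1%:Z w = shift 1 (shift k%:Z w).
  by rewrite shift_shift; congr shift; lia.
apply/funext => i; rewrite subst_seq_shift IH shift_shift.
rewrite -addn1 window_cat subst_word_cat size_cat add0r.
rewrite /(window w k 1) /mkseq /subst_word /= cats0 addr0 /shift add0r.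
by congr subst_seq; rewrite PoszD; lia.
Qed.

(** * Growth of legal words *)

Lemma size_iter_subst_mono phi u i j : (i <= j)%N ->
  (size (iter i (subst_word phi) u) <= size (iter j (subst_word phi) u))%N.
Proof. by move=> /subnK <-; rewrite iterD; apply: size_iter_subst. Qed.

Lemma legal_window phi w i m : subshift phi w -> legal phi (window w i m).
Proof. by move=> Xw; exists w => //; exists i; rewrite size_window. Qed.

Lemma collar_radius_gt0 phi : (0 < collar_radius phi)%N.
Proof. by []. Qed.

(** Tameness makes the maximum that defines the collaring radius a maximum over a
    finite set, so that it is an upper bound. *)
Lemma bounded_legal_size phi u :
  tame phi -> bounded_legal phi u -> (size u < collar_radius phi)%N.
Proof.
move=> tphi Bu; rewrite /collar_radius add1n ltnS fsbig_finite //.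
apply: (@leq_bigmax_seq _ _ xpredT size) => //.
by rewrite in_fset_set // inE.
Qed.

(** Each legal word of this length is expanding, since it is longer than every
    bounded legal word.  There are finitely many such words, and lengths do not
    decrease under the substitution, so one exponent serves them all. *)
Lemma legal_growth phi J : tame phi ->
  exists k, forall u, legal phi u -> size u = collar_radius phi ->
    (J <= size (iter k (subst_word phi) u))%N.
Proof.
move=> tphi.
have /choice[h hP] (t : (collar_radius phi).-tuple A) : exists k,
    legal phi t -> (J <= size (iter k (subst_word phi) t))%N.
  have [lt|nlt] := pselect (legal phi t); last by exists 0%N => /nlt.
  apply: contrapT => /forallNP nJ.
  have bt : bounded_word phi t.
    exists J => k; have /not_implyP[_ /negP] := nJ k.
    by rewrite -ltnNge => /ltnW.
  have : (size t < collar_radius phi)%N.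
    apply: bounded_legal_size => //; split=> //.
    by rewrite -size_eq0 size_tuple.
  by rewrite size_tuple ltnn.
exists (\max_t h t) => u lu /eqP su.
have := hP (Tuple su) lu; move/leq_trans; apply.
exact: (size_iter_subst_mono _ _ (@leq_bigmax _ h (Tuple su))).
Qed.

(** * The subshift as a compact space *)

Lemma nbhs_window (w : {ptws int -> discrete_topology A}) i m :
  \forall w' \near w, window w' i m = window w i m :> seq A.
Proof.
have FF : Filter (nbhs w) by exact: nbhs_filter.
elim: m => [|m IH]; first by apply: (@nearW _ (nbhs w)) => w'.
have : \forall w' \near w, w' (i + m%:Z) = w (i + m%:Z).
  have := @proj_continuous int (fun=> discrete_topology A) (i + m%:Z) w.
  by move=> /(_ [set w (i + m%:Z)]) /=; apply; apply: discrete_set1.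
move=> h; apply: filterS2 IH h.
move=> w' e1 e2; rewrite -addn1 !window_cat e1.
by rewrite /window /mkseq /= addr0 e2.
Qed.

Lemma open_local (C : set {ptws int -> discrete_topology A}) i m :
  (forall w w' : int -> A, window w i m = window w' i m -> C w -> C w') -> open C.
Proof.
move=> locC; rewrite openE => w Cw; rewrite /interior.
have FF : Filter (nbhs w) by exact: nbhs_filter.
by apply: filterS (nbhs_window w i m) => w' e; apply: locC Cw.
Qed.

(** The complement is decided by the same window, and is therefore open. *)
Lemma closed_local (C : set {ptws int -> discrete_topology A}) i m :
  (forall w w' : int -> A, window w i m = window w' i m -> C w -> C w') -> closed C.
Proof.
move=> locC; rewrite -openC; apply: (@open_local _ i m) => w w' e.
by apply: contra_not; apply: locC.
Qed.

Lemma compact_full_shift : compact [set: {ptws int -> discrete_topology A}].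
Proof.
have := @tychonoff int (fun=> discrete_topology A) (fun=> setT)
  (fun _ => @finite_compact (discrete_topology A) setT (@finite_finset A setT)).
by congr compact; apply/seteqP; split.
Qed.

Lemma closed_subshift phi : closed (subshift phi).
Proof.
have -> : subshift phi = \bigcap_(im : int * nat)
    [set w : {ptws int -> discrete_topology A} | admitted phi (window w im.1 im.2)].
  by apply/seteqP; split=> [w Xw im _|w Xw i m]; [apply: Xw | apply: (Xw (i, m))].
apply: closed_bigI => -[i m] _; apply: (@closed_local _ i m) => w w' /=.
by move=> ->.
Qed.

Lemma compact_subshift phi : compact [set: set_type (subshift phi)].
Proof.
apply: compact_set_type; apply: subclosed_compact compact_full_shift _ => //.
exact: closed_subshift.
Qed.

(** * Desubstitution *)

Definition max_image phi : nat := \max_a size (phi a).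

Lemma size_subst_word_le phi u :
  (size (subst_word phi u) <= max_image phi * size u)%N.
Proof.
elim: u => [|a u IH]; first by rewrite /subst_word /= muln0.
rewrite -cat1s subst_word_cat !size_cat mulnDr muln1 leq_add //.
by rewrite addn0 (@leq_bigmax _ (fun a => size (phi a)) a).
Qed.

Lemma subst_word_block phi d u P : (P < size (subst_word phi u))%N ->
  exists c k, [/\ (c < size u)%N, (k < size (phi (nth d u c)))%N &
    P = (size (subst_word phi (take c u)) + k)%N].
Proof.
elim: u P => // a u IH P; rewrite -cat1s subst_word_cat size_cat.
rewrite {1}/subst_word /= cats0 => Pu.
have [Pa|aP] := ltnP P (size (phi a)); first by exists 0%N, P.
have [|c [k [cu ku e]]] := IH (P - size (phi a))%N; first by rewrite ltn_subLR.
exists c.+1, k; split=> //.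
by rewrite /= -cat1s subst_word_cat size_cat /subst_word /= cats0 -addnA -e subnKC.
Qed.

Lemma max_image_gt0 phi (a : A) : (0 < max_image phi)%N.
Proof.
apply: leq_trans (@leq_bigmax _ (fun a => size (phi a)) a).
by rewrite lt0n size_eq0 subst_letter_neq0.
Qed.

(** A long window of [w] occurs in some [phi^(n+1)(a) = phi(v)].  The word [v],
    recentred at the letter whose image contains the origin, is the required
    sequence: each letter of [v] has a short image, so [v] extends far on both
    sides of its centre. *)
Lemma subst_seq_surj_window phi w N : subshift phi w ->
  exists w' k, [/\ (k < max_image phi)%N, admitted phi (window w' (- N%:Z) (N + N)) &
    forall i, - N%:Z <= i -> i < N%:Z -> shift k%:Z (subst_seq phi w') i = w i].
Proof.
move=> Xw; have M0 := max_image_gt0 phi (w 0).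
(* An image has at most max_image letters, so that the L letters of w on either
   side of the origin meet the images of more than N letters of v. *)
have [L LE] : exists L, L = (max_image phi * N.+1)%N by eexists.
have NL : (N < L)%N by rewrite LE; nia.
(* A window of length at least two does not occur in phi^0(a). *)
have [a [[|n] wa]] := Xw (- L%:Z) (L + L)%N.
  by have := size_infix wa; rewrite size_window /=; lia.
set v := iter n (subst_word phi) [:: a].
have /infixP[p [q e]] : infix (window w (- L%:Z) (L + L)) (subst_word phi v) := wa.
have sv : size (subst_word phi v) = (size p + (L + L) + size q)%N.
  by rewrite e !size_cat size_window addnA.
have [|c [k [cv kc Pe]]] := @subst_word_block phi a v (size p + L); first by lia.
have kM : (k < max_image phi)%N.
  exact: leq_trans kc (@leq_bigmax _ (fun a => size (phi a)) _).
have lc : (size (subst_word phi (take c v)) <= max_image phi * c)%N.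
  by have := size_subst_word_le phi (take c v); rewrite size_takel // ltnW.
have rc := size_subst_word_le phi (drop c v).
have sum : size (subst_word phi v) =
    (size (subst_word phi (take c v)) + size (subst_word phi (drop c v)))%N.
  by rewrite -size_cat -subst_word_cat cat_take_drop.
rewrite size_drop in rc.
have Nc : (N <= c)%N by rewrite LE in Pe; nia.
have Nv : (N <= size v - c)%N by rewrite LE in Pe sv; nia.
(* Only the indices from - c on, where the absolute value is harmless, matter. *)
pose w' i := nth a v (absz (c%:Z + i)).
have w'v m j : (m <= size v)%N -> (j + m <= size v)%N ->
    window w' (- c%:Z + j%:Z) m = take m (drop j v).
  move=> mv jm; apply: (@eq_from_nth _ a) => [|l].
    by rewrite size_window size_takel // size_drop; lia.
  rewrite size_window => lm; rewrite nth_window // nth_take // nth_drop /w'.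
  by congr nth; lia.
exists w', k; split=> //.
  exists a, n; rewrite (_ : - N%:Z = - c%:Z + (c - N)%N%:Z); last by lia.
  rewrite w'v; [|lia|lia].
  exact: infix_trans (infix_take _ _) (infix_drop _ _).
move=> i iN Ni; rewrite /shift.
have w'full : window w' (- c%:Z) (c + (size v - c)) = v.
  by have := w'v (size v) 0%N; rewrite addr0 subnKC ?(ltnW cv) // drop0 take_size => ->.
have w'c : window w' (- c%:Z) c = take c v.
  by have := w'v c 0%N; rewrite addr0 drop0 => -> //; lia.
pose j := absz ((size p + L)%N%:Z + i).
have jE : i + k%:Z = j%:Z - (size (subst_word phi (window w' (- c%:Z) c)))%:Z.
  by rewrite w'c /j; lia.
rewrite jE (@subst_seqE _ _ _ a c (size v - c)) w'full; last by rewrite /j; lia.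
have -> : j = (size p + absz (L%:Z + i)%R)%N by rewrite /j; lia.
rewrite e nth_cat ltnNge leq_addr /=.
rewrite addKn nth_cat size_window ifT; last by lia.
by rewrite nth_window; [congr w; lia|lia].
Qed.

(** A compactness argument in the full shift: the approximate desubstitutions of
    [subst_seq_surj_window] have a common limit, and one of the finitely many
    offsets works for arbitrarily large windows. *)
Lemma subst_seq_surj phi w : subshift phi w ->
  exists2 w', subshift phi w' & exists k : nat, w = shift k%:Z (subst_seq phi w').
Proof.
move=> Xw; pose K N := [set w' : {ptws int -> discrete_topology A} |
  admitted phi (window w' (- N%:Z) (N + N)) /\ exists2 k, (k < max_image phi)%N &
    forall i, - N%:Z <= i -> i < N%:Z -> shift k%:Z (subst_seq phi w') i = w i].
have [N|N|N|w' Kw'] := @compact_nested _ K compact_full_shift.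
(* The offset k is less than max_image, so that the letters of index less than
   N + max_image decide the condition. *)
- pose m := (N + max_image phi)%N.
  apply: (@closed_local _ (- m%:Z) (m + m)%N) => u u' uu' [adu [k kM ku]].
  have uuN i : - m%:Z <= i -> i < m%:Z -> subst_seq phi u i = subst_seq phi u' i.
    exact: subst_seq_agree.
  split.
    suff -> : window u' (- N%:Z) (N + N) = window u (- N%:Z) (N + N) by [].
    apply: (@eq_from_nth _ (u 0)) => [|j]; rewrite !size_window // => jN.
    rewrite !nth_window //.
    have := congr1 (fun s => nth (u 0) s (max_image phi + j)) uu'.
    rewrite !nth_window //; [|lia..].
    by have -> : - m%:Z + (max_image phi + j)%N%:Z = - N%:Z + j%:Z by rewrite /m; lia.
  exists k => // i iN Ni; rewrite -ku // /shift uuN //; rewrite /m; lia.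
- by have [u [k [kM adu ku]]] := subst_seq_surj_window N Xw; exists u; split=> //; exists k.
- move=> u [adu [k kM ku]]; split.
    apply: admitted_infix adu; rewrite (_ : N.+1 + N.+1 = 1 + ((N + N) + 1))%N; last by lia.
    rewrite !window_cat (_ : - N.+1%:Z + 1%:Z = - N%:Z); last by lia.
    exact: infix_infix.
  by exists k => // i iN Ni; apply: ku; lia.
exists w'.
  move=> i m; pose N := (absz i + m)%N; have [adw _] := Kw' N.
  apply: admitted_infix adw.
  have -> : (N + N = absz (N%:Z + i)%R + (m + absz (N%:Z - i - m%:Z)%R))%N by rewrite /N; lia.
  rewrite !window_cat; have -> : - N%:Z + (absz (N%:Z + i))%:Z = i by rewrite /N; lia.
  exact: infix_infix.
have [k kP] : exists k : nat, forall N, forall i, - N%:Z <= i -> i < N%:Z ->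
    shift k%:Z (subst_seq phi w') i = w i.
  apply: contrapT => /forallNP nk.
  have /choice[h hP] (k : nat) : exists N : nat, ~ forall i, - N%:Z <= i -> i < N%:Z ->
      shift k%:Z (subst_seq phi w') i = w i by apply/existsNP/nk.
  pose N := \max_(k < max_image phi) h k.
  have [_ [k kM kN]] := Kw' N; apply: (hP k) => i ih hi.
  have hN : (h k <= N)%N := @leq_bigmax _ (fun k : 'I__ => h k) (Ordinal kM).
  by apply: kN; lia.
exists k; apply/funext => i; rewrite (kP (absz i).+1) //; lia.
Qed.

(** Shifting the preimage by whole letters, the offset can be taken inside the
    image of the letter at the origin, as the parametrisation of the tiling space
    demands. *)
Lemma subst_seq_surj_block phi w : subshift phi w ->
  exists2 w', subshift phi w' & exists k : nat,
    (k < size (phi (w' 0)))%N /\ w = shift k%:Z (subst_seq phi w').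
Proof.
move=> /subst_seq_surj[w' Xw' [k wE]].
have [|c [l [ck lc kE]]] := @subst_word_block phi (w' 0) (window w' 0 k.+1) k.
  by apply: leq_trans (size_subst_word _ _); rewrite size_window.
rewrite size_window in ck; rewrite nth_window // add0r in lc.
have tc : take c (window w' 0 k.+1) = window w' 0 c.
  by rewrite -(subnKC (ltnW ck)) window_cat take_size_cat ?size_window.
exists (shift c%:Z w'); first exact: subshift_shift.
exists l; split; first by rewrite /shift add0r.
by rewrite subst_seq_shiftn shift_shift wE {1}kE tc PoszD addrC.
Qed.

End Words.

(** * Compactness of the tiling space *)

Section TilingTopology.
Context (R : realType) {A : finType} (phi : substitution A).
Implicit Types w : subshift phi.

Lemma continuous_subshift (S : topologicalType) (f : S -> set_type (subshift phi)) :
  (forall i x, \forall y \near x, val (f y) i = val (f x) i) -> continuous f.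
Proof.
move=> loc; apply: continuous_set_type; apply: continuous_ptws => i.
by apply: continuous_locally_cst => x; apply: loc.
Qed.

Lemma near_subshift_window (w : set_type (subshift phi)) i m :
  \forall w' \near w, window (val w') i m = window (val w) i m.
Proof. exact: (@initial_continuous _ _ val w _ (nbhs_window (val w) i m)). Qed.

Lemma near_subshift_eq (w : set_type (subshift phi)) i :
  \forall w' \near w, val w' i = val w i.
Proof.
apply: filterS (near_subshift_window w i 1) => w'.
by rewrite /window /mkseq /= addr0 => -[].
Qed.

Lemma sub_shift_continuous k :
  continuous (sub_shift k : set_type (subshift phi) -> set_type (subshift phi)).
Proof. by apply: continuous_subshift => i w; apply: near_subshift_eq. Qed.

Lemma sub_subst_continuous :
  continuous (@sub_subst A phi : set_type (subshift phi) -> set_type (subshift phi)).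
Proof.
apply: continuous_subshift => i w; pose n := (absz i).+1.
apply: filterS (near_subshift_window w (- n%:Z) (n + n)) => w' e.
by apply: (@subst_seq_agree _ _ _ _ n) => //; rewrite /n; lia.
Qed.

Lemma cylinder_height_continuous : continuous (fun x : cylinder R phi => val x.2 : R).
Proof.
move=> x; apply: (@continuous_comp _ (set_type (@unit_interval R)) R snd (fun t => val t)).
  exact: cvg_snd.
exact: initial_continuous.
Qed.

Lemma near_cylinder (x : cylinder R phi) (P : set_type (subshift phi) -> Prop) :
  (\forall w \near x.1, P w) -> \forall y \near x, P y.1.
Proof. by move=> Px; apply: (@cvg_fst _ _ _ _ (nbhs_filter x.2) P Px). Qed.

Lemma compact_cylinder : compact [set: cylinder R phi].
Proof.
rewrite -setXTT; apply: compact_setX; first exact: compact_subshift.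
by apply: compact_set_type; apply: segment_compact.
Qed.

Lemma tile_continuous : continuous (@tile R A phi).
Proof. exact: pi_continuous. Qed.

Lemma continuous_tiling (T : topologicalType) (f : tiling_space R phi -> T) :
  continuous (fun x => f (tile x)) -> continuous f.
Proof. by move=> cf; apply/quotient_continuous. Qed.

Lemma compact_tiling_space : compact [set: tiling_space R phi].
Proof.
have <- : (@tile R A phi) @` setT = setT.
  by apply/seteqP; split=> // x _; exists (tile_repr x); rewrite ?tile_reprK.
apply: continuous_compact; last exact: compact_cylinder.
by apply: continuous_subspaceT; apply: tile_continuous.
Qed.

(** * Continuity of the map of the tiling space *)

Lemma clamp_subproof (s : R) : (`|s| - `|s - 1| + 1) / 2 \in @unit_interval R.
Proof.
rewrite inE /unit_interval /= in_itv /=.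
by apply/andP; case: (ger0P s) => s0; case: (ger0P (s - 1)) => s1; split; lra.
Qed.

(** The retraction of the line onto the unit interval, written with absolute
    values so that its continuity is immediate. *)
Definition clamp (s : R) : @unit_interval R :=
  exist (fun r => r \in @unit_interval R) _ (clamp_subproof s).

Lemma clampE (s : R) : 0 <= s <= 1 -> val (clamp s) = s.
Proof.
move=> /andP[s0 s1]; rewrite /= ger0_norm // ler0_norm; last by lra.
by field.
Qed.

Lemma clamp_continuous : continuous (clamp : R -> set_type (@unit_interval R)).
Proof.
apply: continuous_set_type => s /=; apply: cvgM; last exact: cvg_cst.
apply: cvgD; last exact: cvg_cst.
apply: cvgB; apply: cvg_norm; first exact: cvg_id.
by apply: cvgB; [exact: cvg_id | exact: cvg_cst].
Qed.

(** The translation of [(w, 0)] by [s]; through it the map of the tiling space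
    becomes a composition of continuous maps. *)
Definition flow w (s : R) : tiling_space R phi :=
  tile (sub_shift (Num.floor s) w, fracpart s).

(** On the closed interval from [k] to [k+1] the floor can be taken to be [k] up to the
    right end point, where the gluing relation identifies the two readings. *)
Lemma flow_clamp w s (k : int) : k%:~R <= s <= k%:~R + 1 ->
  flow w s = tile (sub_shift k w, clamp (s - k%:~R)).
Proof.
move=> /andP[ks sk]; have [e|ne] := eqVneq s (k%:~R + 1).
  have fs : Num.floor s = k + 1 by rewrite e -intrD1 intrKfloor.
  symmetry; apply/tile_eq; apply: rst_step; split.
  - by rewrite clampE e; lra.
  - by rewrite /= fs e intrD1 subrr.
  - by rewrite /= fs; apply/funext => i; rewrite /shift; congr (val w _); lia.
have fs : Num.floor s = k.
  by apply: floor_def; rewrite ks intrD1 lt_neqAle ne.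
rewrite /flow fs; congr tile; congr pair; apply: val_inj.
rewrite clampE /= ?fs //; apply/andP; split; lra.
Qed.

(** By [flow_clamp] the flow is glued from continuous maps defined on unit
    intervals of heights; at most two of them matter near a given height. *)
Lemma flow_continuous :
  continuous (fun p : set_type (subshift phi) * R => flow p.1 p.2).
Proof.
pose T k (p : set_type (subshift phi) * R) : tiling_space R phi :=
  tile (sub_shift k p.1, clamp (p.2 - k%:~R)).
have cT k : continuous (T k).
  apply: continuous_compose (@tile_continuous); apply: continuous_pair.
    apply: continuous_compose (@sub_shift_continuous k) => p; exact: cvg_fst.
  apply: continuous_compose clamp_continuous => p.
  by apply: cvgB; [exact: cvg_snd | exact: cvg_cst].
move=> [w s] U FU; set k := Num.floor s.
have ks : k%:~R <= s by exact: floor_le.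
have sk : s < k%:~R + 1 by rewrite -intrD1 floorD1_gt.
have near_snd (P : R -> Prop) : (\forall r \near s, P r) -> \forall q \near (w, s), P q.2.
  by move=> Ps; apply: (@cvg_snd _ _ _ _ (nbhs_filter w) P Ps).
have FT : \forall q \near (w, s), U (T k q).
  by apply: cT; rewrite /T -flow_clamp // ks ltW.
have sk' := near_snd _ (lt_nbhsl sk).
have [e|ne] := eqVneq s k%:~R; last first.
  have kl : k%:~R < s by rewrite lt_neqAle eq_sym ne.
  apply: filterS3 FT sk' (near_snd _ (lt_nbhsr kl)) => -[w' s'] /= UT s'k ks'.
  by rewrite (@flow_clamp _ _ k) // !ltW.
have FT' : \forall q \near (w, s), U (T (k - 1) q).
  by apply: cT; rewrite /T -flow_clamp // intrB mulr1z e; apply/andP; split; lra.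
have ks' : (k - 1)%:~R < s by rewrite intrB mulr1z; lra.
apply: filterS3 FT FT' (filterI sk' (near_snd _ (lt_nbhsr ks'))) => -[w' s'] /=.
move=> UT UT' [s'k ks'']; have [kl|lk] := leP k%:~R s'.
  by rewrite (@flow_clamp _ _ k) // kl ltW.
rewrite (@flow_clamp _ _ (k - 1)) // (ltW ks'') intrB mulr1z /=; lra.
Qed.

Lemma tiling_map_flow w (t : @unit_interval R) :
  tiling_map (tile (w, t)) = flow (sub_subst w) ((size (phi (val w 0)))%:R * val t).
Proof. by rewrite tiling_mapE. Qed.

Lemma tiling_map_continuous : continuous (@tiling_map R A phi).
Proof.
apply: continuous_tiling.
have -> : (fun x => tiling_map (tile x)) = (fun x : cylinder R phi =>
    flow (sub_subst x.1) ((size (phi (val x.1 0)))%:R * val x.2)).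
  by apply/funext => -[w t]; apply: tiling_map_flow.
pose f (x : cylinder R phi) := (sub_subst x.1, (size (phi (val x.1 0)))%:R * val x.2).
apply: (@continuous_compose _ _ _ f _ _ flow_continuous); apply: continuous_pair.
  apply: (@continuous_compose (cylinder R phi) _ _ fst (@sub_subst A phi)).
    by move=> x; exact: cvg_fst.
  exact: sub_subst_continuous.
move=> x; apply: cvgM; last exact: cylinder_height_continuous.
apply: cvg_near_cst.
by apply: filterS (near_cylinder (near_subshift_eq x.1 0)) => y /= ->.
Qed.

(** * Separation of points of the tiling space *)

(** A representative with height less than one; being constant on the classes of
    the gluing relation, it shows that such representatives are unique. *)
Definition normal_form (x : cylinder R phi) : (int -> A) * R :=
  if val x.2 == 1 then (shift 1 (val x.1), 0) else (val x.1, val x.2).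

Lemma normal_form_tile (x y : cylinder R phi) :
  tile x = tile y -> normal_form x = normal_form y.
Proof.
move=> /tile_eq; elim=> [[w t] [w' t'] [/= t1 t0 ww']|//|u v _ ->//|u v z _ -> _ ->//].
by rewrite /normal_form /= t1 t0 eqxx eq_sym oner_eq0 ww'.
Qed.

Lemma tile_inj w w' (t t' : @unit_interval R) : val t < 1 -> val t' < 1 ->
  tile (w, t) = tile (w', t') -> w = w' /\ t = t'.
Proof.
move=> t1 t1' /normal_form_tile; rewrite /normal_form /= !lt_eqF //.
by case=> ww' tt'; split; apply: val_inj.
Qed.

Lemma unit_interval_bounds (t : @unit_interval R) : 0 <= val t <= 1.
Proof. by have /set_mem := valP t; rewrite /unit_interval /= in_itv. Qed.

(** The three conditions at the end points are exactly those under which the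
    formula takes the same value at [(w, 1)] and [(sigma w, 0)].  All the
    functions that separate points below have this form. *)
Lemma blend_lift (c0 c1 : R -> R) (g : subshift phi -> R) :
  continuous c0 -> continuous c1 -> c0 1 = 0 -> c1 0 = 0 -> c1 1 = c0 0 ->
  (forall w : set_type (subshift phi), \forall w' \near w, g w' = g w) ->
  exists2 f : tiling_space R phi -> R, continuous f &
    forall w t, f (tile (w, t)) = c0 (val t) * g w + c1 (val t) * g (sub_shift 1 w).
Proof.
move=> cc0 cc1 c01 c10 c11 lg.
pose F (x : cylinder R phi) := c0 (val x.2) * g x.1 + c1 (val x.2) * g (sub_shift 1 x.1).
have Fglue x y : glue x y -> F x = F y.
  case: x y => [w t] [w' t'] [/= t1 t0 ww'].
  have -> : w' = sub_shift 1 w by apply: val_inj.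
  by rewrite /F /= t1 t0 c01 c10 c11 !mul0r add0r addr0.
have FE x : F (tile_repr (tile x)) = F x.
  have /tile_eq := tile_reprK (tile x); move: (tile_repr (tile x)) => y.
  by elim=> [u v /Fglue ->|//|u v _ ->//|u v z _ -> _ ->//].
have lgc (h : set_type (subshift phi) -> set_type (subshift phi)) :
    continuous h -> continuous (fun x : cylinder R phi => g (h x.1)).
  move=> ch; have cg : continuous (g : set_type (subshift phi) -> R).
    exact: continuous_locally_cst.
  move=> x; apply: (@continuous_compose (cylinder R phi) _ _ fst (fun w => g (h w))).
    by move=> y; exact: cvg_fst.
  exact: (continuous_compose ch cg).
exists (F \o tile_repr (phi := phi)); last by move=> w t; rewrite /= FE.
apply: continuous_tiling.
have -> : (fun x => (F \o tile_repr (phi := phi)) (tile x)) = F.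
  by apply/funext => x; apply: FE.
have ch := cylinder_height_continuous.
move=> x; apply: cvgD; apply: cvgM.
- exact: (@continuous_compose _ _ _ _ _ ch cc0).
- by apply: (lgc id) => w; exact: cvg_id.
- exact: (@continuous_compose _ _ _ _ _ ch cc1).
- by apply: (lgc (sub_shift 1)); apply: sub_shift_continuous.
Qed.

(** The two functions are continuous on the circle, and their quotient recovers
    the height where they do not vanish. *)
Lemma height_separated (s t : R) : 0 <= s < 1 -> 0 <= t < 1 ->
  s * (1 - s) = t * (1 - t) -> s ^+ 2 * (1 - s) = t ^+ 2 * (1 - t) -> s = t.
Proof.
move=> /andP[s0 s1] /andP[t0 t1] e1 e2.
have : s * (1 - s) * (s - t) = 0.
  have -> : s * (1 - s) * (s - t) = s ^+ 2 * (1 - s) - t * (s * (1 - s)) by ring.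
  by rewrite e2 e1; ring.
move=> /eqP; rewrite !mulf_eq0 !subr_eq0 => /orP[/orP[/eqP s00|/eqP se]|/eqP //].
  have : t * (1 - t) = 0 by rewrite -e1 s00 mul0r.
  move/eqP; rewrite mulf_eq0 => /orP[/eqP ->|]; first by rewrite s00.
  by rewrite subr_eq0 => /eqP te; move: t1; rewrite -te ltxx.
by move: s1; rewrite -se ltxx.
Qed.

Lemma bump_continuous : continuous (fun s : R => s * (1 - s)).
Proof.
move=> s; apply: cvgM; first exact: cvg_id.
by apply: cvgB; [exact: cvg_cst | exact: cvg_id].
Qed.

Lemma skew_bump_continuous : continuous (fun s : R => s ^+ 2 * (1 - s)).
Proof.
have -> : (fun s : R => s ^+ 2 * (1 - s)) = (fun s : R => s * (s * (1 - s))).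
  by apply/funext => s; ring.
by move=> s; apply: cvgM; [exact: cvg_id | exact: bump_continuous].
Qed.

Lemma cobump_continuous : continuous (fun s : R => 1 - s).
Proof. by move=> s; apply: cvgB; [exact: cvg_cst | exact: cvg_id]. Qed.

Lemma id_continuous : continuous (fun s : R => s).
Proof. by move=> s; exact: cvg_id. Qed.

Lemma zero_continuous : continuous (fun _ : R => 0 : R).
Proof. by move=> s; exact: cvg_cst. Qed.

Lemma near_letter_indicator i a (w : set_type (subshift phi)) :
  \forall w' \near w, (val w' i == a)%:R = (val w i == a)%:R :> R.
Proof. by apply: filterS (near_subshift_eq w i) => w' ->. Qed.

(** Heights are separated by functions of the height alone.  At equal heights,
    letters are separated by their indicator functions, multiplied by [t(1-t)]
    inside an edge and interpolated linearly along the edge at a vertex. *)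
Lemma hausdorff_tiling_space : hausdorff_space (tiling_space R phi).
Proof.
apply: (@hausdorff_separating R) => x y.
have [w [t [t1 ->]]] := tile_surj x; have [w' [t' [t1' ->]]] := tile_surj y => sep.
have /andP[t0 _] := unit_interval_bounds t.
have /andP[t0' _] := unit_interval_bounds t'.
have cst1 (w0 : set_type (subshift phi)) : \forall w1 \near w0, 1 = 1 :> R.
  by apply: filterS (near_subshift_eq w0 0).
have [f cf fE] := @blend_lift _ _ (fun=> 1) bump_continuous zero_continuous
  ltac:(ring) ltac:(ring) ltac:(ring) cst1.
have [f' cf' fE'] := @blend_lift _ _ (fun=> 1) skew_bump_continuous zero_continuous
  ltac:(ring) ltac:(ring) ltac:(ring) cst1.
have tt : t = t'.
  apply: val_inj; apply: height_separated; rewrite ?t0 ?t0' //.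
    by have := sep f cf; rewrite !fE !mul0r !addr0 !mulr1.
  by have := sep f' cf'; rewrite !fE' !mul0r !addr0 !mulr1.
rewrite -tt in sep *; congr (tile (_, _)); apply: val_inj; apply/funext => i.
have ind_inj : (val w i == val w i)%:R = (val w' i == val w i)%:R :> R -> val w i = val w' i.
  by rewrite eqxx; case: eqP => // _ /eqP; rewrite oner_eq0.
apply: ind_inj; move: t0; rewrite le_eqVlt => /predU1P[tz|tp].
  have [h ch hE] := @blend_lift _ _ (fun w1 => (val w1 i == val w i)%:R) cobump_continuous
    id_continuous ltac:(ring) ltac:(ring) ltac:(ring) (near_letter_indicator i (val w i)).
  by have := sep h ch; rewrite !hE -tz !mul0r !addr0 subr0 !mul1r.
have [h ch hE] := @blend_lift _ _ (fun w1 => (val w1 i == val w i)%:R) bump_continuous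
  zero_continuous ltac:(ring) ltac:(ring) ltac:(ring) (near_letter_indicator i (val w i)).
have := sep h ch; rewrite !hE !mul0r !addr0; apply: mulfI.
by rewrite mulf_neq0 // ?gt_eqF // subr_gt0.
Qed.

(** * Inverting the map of the tiling space *)

Lemma flow_add w (k : nat) (t : @unit_interval R) : val t < 1 ->
  flow w (k%:R + val t) = tile (sub_shift k%:Z w, t).
Proof.
move=> t1; have /andP[t0 _] := unit_interval_bounds t.
have fl : Num.floor (k%:R + val t) = k%:Z.
  by apply: floor_def; rewrite -pmulrn lerDl t0 intrD1 -pmulrn ltrD2l.
rewrite /flow fl; congr (tile (_, _)); apply: val_inj.
by rewrite /= fl -pmulrn addrC addKr.
Qed.

(** If [w] is the image of [w'] shifted by [k] letters inside the block of
    [w'_0], the preimage of [(w, t)] is [w'] at the height that is stretched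
    to [k + t]. *)
Lemma tiling_map_surj (x : tiling_space R phi) : exists y, tiling_map y = x.
Proof.
have [w [t [t1 ->]]] := tile_surj x.
have /andP[t0 _] := unit_interval_bounds t.
have [w' Xw' [k [kw' wE]]] := subst_seq_surj_block (set_mem (valP w)).
pose v : subshift phi := exist _ w' (mem_set Xw').
have L0 : 0 < (size (phi (w' 0)))%:R :> R by rewrite ltr0n (leq_ltn_trans _ kw').
have kL : k%:R + val t < (size (phi (w' 0)))%:R :> R.
  have : k.+1%:R <= (size (phi (w' 0)))%:R :> R by rewrite ler_nat.
  by rewrite -natr1; lra.
have sI : (k%:R + val t) / (size (phi (w' 0)))%:R \in @unit_interval R.
  rewrite inE /unit_interval /= in_itv /= divr_ge0 ?addr_ge0 ?ler0n //=.
  by rewrite ler_pdivrMr // mul1r ltW.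
exists (tile (v, exist (fun r => r \in @unit_interval R) _ sI)).
rewrite tiling_map_flow /= mulrC divfK ?gt_eqF // flow_add //.
by congr (tile (_, _)); apply: val_inj.
Qed.

Lemma tiling_map_invK : cancel (@tiling_map_inv R A phi) (@tiling_map R A phi).
Proof.
move=> x; apply: pinvK; rewrite inE; have [y <-] := tiling_map_surj x.
by exists y.
Qed.

Lemma tiling_mapK : recognisable R phi ->
  cancel (@tiling_map R A phi) (@tiling_map_inv R A phi).
Proof.
by move=> rphi x; apply: pinvKV; rewrite ?inE // => y z _ _; apply: rphi.
Qed.

Lemma tiling_map_inv_continuous : recognisable R phi ->
  continuous (@tiling_map_inv R A phi).
Proof.
move=> rphi; apply: (continuous_compact_inverse _ _ tiling_map_continuous
  (tiling_mapK rphi) tiling_map_invK).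
  exact: compact_tiling_space.
exact: hausdorff_tiling_space.
Qed.

End TilingTopology.

(** * Anderson-Putnam complexes *)

Section AndersonPutnam.
Context (R : realType) {A : finType} (phi : substitution A).
Implicit Types (w : subshift phi) (t : @unit_interval R).

Lemma ap_proj_continuous : continuous (@ap_proj R A phi).
Proof. exact: pi_continuous. Qed.

Lemma ap_lift (f : tiling_space R phi -> R) : continuous f ->
  (forall x y, ap_step x y -> f x = f y) ->
  exists2 F : ap_complex R phi -> R, continuous F & forall x, F (ap_proj x) = f x.
Proof.
move=> cf fstep; pose r (z : ap_complex R phi) : tiling_space R phi :=
  repr (z : {eq_quot ap_equiv R phi}).
have FE x : f (r (ap_proj x)) = f x.
  have /ap_proj_eq := ap_projK (ap_proj x); rewrite -/(r _); move: (r _) => y.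
  by elim=> [u v /fstep //|u v z _ -> _ ->].
exists (f \o r) => //; apply/quotient_continuous.
suff -> : (f \o r) \o \pi_(ap_complex R phi) = f by [].
by apply/funext => x; apply: FE.
Qed.

Definition unit0 : @unit_interval R := exist (fun r => r \in @unit_interval R) 0 (unit_interval0 R).

(** The complex identifies points that have the edge at the origin in common and,
    at a vertex, also points that have the preceding edge in common; the last two
    conditions make the function constant along both kinds of identification. *)
Lemma ap_lift_blend (c0 c1 : R -> R) (g : subshift phi -> R) :
  continuous c0 -> continuous c1 -> c0 1 = 0 -> c1 0 = 0 -> c1 1 = c0 0 ->
  (forall w : set_type (subshift phi), \forall w' \near w, g w' = g w) ->
  (forall w w' t, val w 0 = val w' 0 -> c0 (val t) * g w + c1 (val t) * g (sub_shift 1 w) =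
    c0 (val t) * g w' + c1 (val t) * g (sub_shift 1 w')) ->
  (forall w w', val w (-1) = val w' (-1) -> c0 0 * g w = c0 0 * g w') ->
  exists2 F : ap_complex R phi -> R, continuous F & forall w t, val t < 1 ->
    F (ap_proj (tile (w, t))) = c0 (val t) * g w + c1 (val t) * g (sub_shift 1 w).
Proof.
move=> cc0 cc1 c01 c10 c11 lg g0 gN1.
have [f cf fE] := blend_lift cc0 cc1 c01 c10 c11 lg.
have [|F cF FE] := ap_lift cf; last by exists F => // w t _; rewrite FE fE.
move=> _ _ [w [w' [t [t1 -> -> h]]]]; rewrite !fE.
case: h => [[_ /g0 //]|[tz [/gN1 e|/g0 //]]].
by rewrite tz c10 !mul0r !addr0.
Qed.

(** An Anderson-Putnam complex is a finite graph.  Points inside edges are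
    separated by their height and by the indicator of the edge; a vertex is
    separated from the others by its tent function, which is one there, zero at
    the other vertices and linear along each edge. *)
Lemma hausdorff_ap_complex : hausdorff_space (ap_complex R phi).
Proof.
apply: (@hausdorff_separating R) => x y.
rewrite -(ap_projK x) -(ap_projK y).
have [w [t [t1 ->]]] := tile_surj (repr (x : {eq_quot ap_equiv R phi})).
have [w' [t' [t1' ->]]] := tile_surj (repr (y : {eq_quot ap_equiv R phi})) => sep.
have /andP[t0 _] := unit_interval_bounds t.
have /andP[t0' _] := unit_interval_bounds t'.
have cst1 (w0 : set_type (subshift phi)) : \forall w1 \near w0, 1 = 1 :> R.
  by apply: filterS (near_subshift_eq w0 0).
have [f cf fE] := @ap_lift_blend _ _ (fun=> 1) (@bump_continuous R) (@zero_continuous R)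
  ltac:(ring) ltac:(ring) ltac:(ring) cst1 ltac:(by []) ltac:(by []).
have [f' cf' fE'] := @ap_lift_blend _ _ (fun=> 1) (@skew_bump_continuous R) (@zero_continuous R)
  ltac:(ring) ltac:(ring) ltac:(ring) cst1 ltac:(by []) ltac:(by []).
have tt : t = t'.
  apply: val_inj; apply: height_separated; rewrite ?t0 ?t0' //.
    by have := sep f cf; rewrite !fE // !mul0r !addr0 !mulr1.
  by have := sep f' cf'; rewrite !fE' // !mul0r !addr0 !mulr1.
rewrite -tt in sep *; move: t0; rewrite le_eqVlt => /predU1P[tz|tp]; last first.
  have [|||h ch hE] := @ap_lift_blend _ _ (fun w1 => (val w1 0 == val w 0)%:R)
    (@bump_continuous R) (@zero_continuous R) ltac:(ring) ltac:(ring) ltac:(ring).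
  - exact: near_letter_indicator.
  - by move=> w1 w2 s ->; rewrite !mul0r.
  - by move=> w1 w2 _; rewrite !mul0r.
  have := sep h ch; rewrite !hE // !mul0r !addr0 eqxx => /mulfI e.
  apply/ap_proj_eq; apply: t_step; exists w, w', t; split=> //; left; split=> //.
  have bn : val t * (1 - val t) != 0 by rewrite mulf_neq0 // ?gt_eqF // subr_gt0.
  by have := e bn; case: eqP => [->|_ /eqP] //; rewrite oner_eq0.
have tE : t = unit0 by apply: val_inj.
rewrite tE in sep t1 *.
have step w1 w2 : val w1 (-1) = val w2 (-1) \/ val w1 0 = val w2 0 ->
    ap_proj (tile (w1, unit0)) = ap_proj (tile (w2, unit0)).
  move=> h; apply/ap_proj_eq; apply: t_step; exists w1, w2, unit0; split=> //.
  by right.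
have [|||h ch hE] := @ap_lift_blend _ _
    (fun w1 => `[< ap_proj (tile (w1, unit0)) = ap_proj (tile (w, unit0)) >]%:R)
    (@cobump_continuous R) (@id_continuous R) ltac:(ring) ltac:(ring) ltac:(ring).
- move=> w1; apply: filterS (near_subshift_eq w1 0) => w2 e.
  by rewrite (step w2 w1) //; right.
- move=> w1 w2 s e; rewrite (step w1 w2); last by right.
  by rewrite (step (sub_shift 1 w1) (sub_shift 1 w2)) //; left.
- by move=> w1 w2 e; rewrite (step w1 w2) //; left.
have := sep h ch; rewrite !hE // !mul0r !addr0 subr0 !mul1r asboolT //.
by case: asboolP => // _ /eqP; rewrite oner_eq0.
Qed.

End AndersonPutnam.

(** * Collared sequences *)

Section Collar.
Context {A : finType} (phi : substitution A) (b : A) (n : nat).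

Local Notation phin := (collar_subst phi b n).

Lemma infix_map (T1 T2 : eqType) (f : T1 -> T2) (s t : seq T1) :
  infix s t -> infix (map f s) (map f t).
Proof. by move=> /infixP[p [q ->]]; rewrite !map_cat infix_infix. Qed.

Lemma nth_cat_middle (T : Type) d (p s q : seq T) j : (j < size s)%N ->
  nth d (p ++ s ++ q) (size p + j) = nth d s j.
Proof. by move=> js; rewrite nth_cat ltnNge leq_addr /= addKn nth_cat js. Qed.

Lemma infix_iter_subst (B : finType) (psi : substitution B) k (s t : seq B) :
  infix s t -> infix (iter k (subst_word psi) s) (iter k (subst_word psi) t).
Proof. by move=> st; elim: k => //= k; apply: infix_subst. Qed.

Lemma tuple_decomp (u : n.*2.+1.-tuple A) : exists x a z,
  [/\ tval u = x ++ a :: z, size x = n & size z = n].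
Proof.
exists (take n u), (center u), (drop n.+1 u).
have su := size_tuple u; split; last 2 first.
- by rewrite size_takel // su; lia.
- by rewrite size_drop su; lia.
rewrite -[LHS](cat_take_drop n) (drop_nth (center u)); last by rewrite su ltnS -addnn leq_addr.
congr (_ ++ _ :: _); rewrite /center (tnth_nth (center u)) inordK; last by lia.
by apply: set_nth_default; rewrite su; lia.
Qed.

(** A collared letter occurs in an iterate of a seed, and collaring commutes with
    substitution; so the words admitted for the collared substitution are read
    in the collaring of a word [phi^k(a)] with enough context on both sides. *)
Lemma collar_admitted s : admitted phin s -> exists k a x z,
  [/\ (n <= size x)%N, (n <= size z)%N &
  infix (map val s) (collars b n x (iter k (subst_word phi) [:: a]) z)].
Proof.
move=> [u [k su]]; have /asboolP[v [l [_ uv]]] := valP u.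
have [x [a [z [ve xn zn]]]] := tuple_decomp v.
exists (k + l)%N, a, (iter (k + l) (subst_word phi) x), (iter (k + l) (subst_word phi) z).
have sx := size_iter_subst phi (k + l) x.
have sz := size_iter_subst phi (k + l) z.
rewrite xn in sx; rewrite zn in sz; split=> //.
rewrite -iter_subst_collars ?xn ?zn // (collars1 b ve xn) iterD.
apply: infix_trans (infix_map val su) _; rewrite map_iter_collar_subst.
apply: infix_iter_subst => /=; have /splitPr[p q] := uv.
by rewrite -cat1s infix_infix.
Qed.

Lemma nth_collars d x y z j (u0 : n.*2.+1.-tuple A) : (n <= size x)%N -> (j < size y)%N ->
  nth u0 (collars d n x y z) j = [tuple nth d (x ++ y ++ z) (size x + j - n + l) | l < n.*2.+1].
Proof. by move=> nx jy; rewrite nth_mkseq. Qed.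

Lemma map_center_collars d x y z : (n <= size x)%N ->
  map (@center A n) (collars d n x y z) = y.
Proof.
move=> nx; apply: (@eq_from_nth _ d); first by rewrite size_map size_mkseq.
rewrite size_map size_mkseq => j jy; rewrite -map_comp (nth_map 0%N) ?size_iota //=.
rewrite nth_iota // /center tnth_mktuple inordK; last by lia.
rewrite nth_cat ifF; last by lia.
by rewrite nth_cat ifT; [congr nth|]; lia.
Qed.

Definition center_seq (w : int -> collar_alphabet phi b n) (i : int) : A :=
  center (val (w i)).

Lemma map_center_window w i m :
  window (center_seq w) i m = map (@center A n) (map val (window w i m)).
Proof. by rewrite /window /mkseq -!map_comp. Qed.

Lemma center_seq_subshift w : subshift phin w -> subshift phi (center_seq w).
Proof.
move=> Xw i m; have [k [a [x [z [nx nz inf]]]]] := collar_admitted (Xw i m).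
exists a, k; rewrite map_center_window -[X in infix _ X](map_center_collars b _ z nx).
exact: infix_map.
Qed.

(** The window of length [2n+1] around [i] occurs inside the collaring of one
    word, where the collar of a letter lists the centres of its neighbours. *)
Lemma collar_tuple_center_seq w i : subshift phin w ->
  collar_tuple n (center_seq w) i = val (w i).
Proof.
move=> Xw; have [k [a [x [z [nx nz inf]]]]] := collar_admitted (Xw (i - n%:Z) n.*2.+1).
set y := iter k _ _ in inf.
have [p [q e]] : exists p q : seq (n.*2.+1.-tuple A),
    collars b n x y z = p ++ map val (window w (i - n%:Z) n.*2.+1) ++ q.
  by have /infixP[p [q e]] := inf; exists p, q.
have sy : (size p + n.*2.+1 + size q = size y)%N.
  have : size (collars b n x y z) = size y by rewrite size_mkseq.
  by rewrite e !size_cat size_map size_window addnA.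
have E (j : nat) : (j < n.*2.+1)%N -> val (w (i - n%:Z + j%:Z)) =
    [tuple nth b (x ++ y ++ z) (size x + (size p + j) - n + l) | l < n.*2.+1].
  move=> jn; rewrite -(@nth_collars _ _ _ _ _ (val (w i))) //; last by lia.
  rewrite e (@nth_cat_middle (n.*2.+1.-tuple A)); last by rewrite size_map size_window.
  by rewrite (nth_map (w i)) ?size_window // nth_window.
have -> : i = i - n%:Z + n%:Z by lia.
rewrite E; last by lia.
apply: eq_from_tnth => l; rewrite !tnth_mktuple addrK /center_seq E; last by [].
rewrite /center tnth_mktuple inordK; last by lia.
by congr nth; lia.
Qed.

(** Collaring is a conjugacy onto the collared subshift, with the sequence of
    centres as its inverse. *)
Lemma collar_map_surj (W : subshift phin) : exists w, collar_map b n w = W.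
Proof.
have XW := set_mem (valP W).
exists (exist _ (center_seq (val W)) (mem_set (center_seq_subshift XW))).
apply: val_inj; apply/funext => i; apply: val_inj.
exact: collar_tuple_center_seq.
Qed.

Lemma collar_tuple_inj (w w' : int -> A) i j :
  collar_tuple n w i = collar_tuple n w' i ->
  i - n%:Z <= j -> j <= i + n%:Z -> w j = w' j.
Proof.
move=> e ij ji; have jn : (absz (j - i + n%:Z)%R < n.*2.+1)%N by lia.
have := congr1 (fun u => tnth u (Ordinal jn)) e.
rewrite !tnth_mktuple /=.
by have -> : i - n%:Z + (absz (j - i + n%:Z))%:Z = j by lia.
Qed.

Lemma collar_map_continuous :
  continuous (@collar_map A phi b n : set_type (subshift phi) -> set_type (subshift phin)).
Proof.
apply: continuous_subshift => i w.
apply: filterS (near_subshift_window w (i - n%:Z) n.*2.+1) => w' e.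
by do 2!apply: val_inj; rewrite /= !collar_tupleE.
Qed.

End Collar.

(** * The projection to the collared complex *)

Section CollaredProjection.
Context (R : realType) {A : finType} (phi : substitution A) (b : A) (n : nat).

Local Notation phin := (collar_subst phi b n).

Lemma collar_tiling_continuous : continuous (@collar_tiling R A phi b n).
Proof.
apply: continuous_tiling.
have -> : (fun x => collar_tiling b n (tile x)) =
    (fun x : cylinder R phi => tile ((collar_map b n x.1, x.2) : cylinder R phin)).
  by apply/funext => x; rewrite collar_tilingE.
apply: continuous_compose (@tile_continuous R _ phin).
apply: (@continuous_pair (cylinder R phi)); last by move=> x; exact: cvg_snd.
apply: (@continuous_compose (cylinder R phi) _ _ fst (@collar_map A phi b n)).
  by move=> x; exact: cvg_fst.
exact: collar_map_continuous.
Qed.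

Lemma collared_proj_continuous : continuous (@collared_proj R A phi b n).
Proof.
exact: (continuous_compose collar_tiling_continuous (@ap_proj_continuous R _ phin)).
Qed.

Lemma collared_proj_surj z : exists x, @collared_proj R A phi b n x = z.
Proof.
have [W [t [_ e]]] := tile_surj (repr (z : {eq_quot ap_equiv R phin})).
have [w wW] := collar_map_surj W.
exists (tile (w, t)); rewrite /collared_proj collar_tilingE -(ap_projK z) e.
by rewrite /collar_cylinder /= wW.
Qed.

(** The collared letters at [-1] and [0] both see the letters at the positions
    [- n, ..., n - 1], so that this window is constant along chains of
    identifications at a vertex; inside an edge the collared letter at [0] also
    sees the letter at [n]. *)
Lemma collared_proj_agree (w w' : subshift phi) (t t' : @unit_interval R) :
  val t < 1 -> val t' < 1 ->
  collared_proj b n (tile (w, t)) = collared_proj b n (tile (w', t')) ->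
  t = t' /\ forall i : int, - n%:Z <= i -> i < n%:Z + ((0 < val t)%R : nat)%:Z ->
    val w i = val w' i.
Proof.
move=> t1 t1'; rewrite /collared_proj !collar_tilingE => /ap_proj_eq.
rewrite /collar_cylinder /=.
(* Every point of the collared tiling space comes from phi, so the claim can be
   carried along a chain of identifications. *)
pose P (x y : tiling_space R phin) := forall (w w' : subshift phi) (t t' : @unit_interval R),
  val t < 1 -> val t' < 1 -> x = tile (collar_map b n w, t) -> y = tile (collar_map b n w', t') ->
  t = t' /\ forall i : int, - n%:Z <= i -> i < n%:Z + ((0 < val t)%R : nat)%:Z ->
    val w i = val w' i.
suff PP x y : clos_trans (tiling_space R phin) (ap_step (phi := phin)) x y -> P x y.
  by move=> /PP; apply.
have cinj (v v' : subshift phi) i : val (collar_map b n v) i = val (collar_map b n v') i ->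
    collar_tuple n (val v) i = collar_tuple n (val v') i.
  by move=> /(congr1 val).
elim=> {w w' t t' t1 t1' x y} [x y [W [W' [s [s1 -> -> h]]]]|x y z _ xy _ yz] w w' t t' t1 t1'.
  move=> /tile_inj-/(_ s1 t1)[WE st] /tile_inj-/(_ s1 t1')[WE' st'].
  rewrite -st -st'; split=> // i ni iN; case: h => [[s0 h]|[s0 [h|h]]];
    move: h; rewrite WE WE' => /cinj h; apply: (collar_tuple_inj h); move: iN;
    rewrite s0 ?ltxx /=; lia.
have [Y [s [s1 yE]]] := tile_surj y; have [v vY] := collar_map_surj Y.
rewrite -vY in yE => xE zE.
have [ts wv] := xy _ _ _ _ t1 s1 xE yE; have [st vw] := yz _ _ _ _ s1 t1' yE zE.
by split=> [|i ni iN]; [rewrite ts|rewrite wv // vw // -ts].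
Qed.

End CollaredProjection.

(** * Injectivity of the map to the inverse limit *)

Section Injectivity.
Context (R : realType) {A : finType} (phi : substitution A).

Lemma val_iter_sub_subst i (w : subshift phi) :
  val (iter i (@sub_subst A phi) w) = iter i (subst_seq phi) (val w).
Proof. by elim: i => //= i ->. Qed.

(** The position reached after [i] steps inside [phi^i(w_0)] depends on [w_0] and
    [t] alone, so two points with these data in common move in parallel; the
    vertices of the tiling are mapped to vertices. *)
Lemma iter_tiling_map_tile i (w w' : subshift phi) (t : @unit_interval R) :
  val w 0 = val w' 0 -> val t < 1 ->
  exists (k : nat) (s : @unit_interval R),
    [/\ (k < size (iter i (subst_word phi) [:: val w 0]))%N, val s < 1,
        val t = 0 -> k = 0%N /\ val s = 0,
        iter i (@tiling_map R A phi) (tile (w, t)) =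
          tile (sub_shift k%:Z (iter i (@sub_subst A phi) w), s) &
        iter i (@tiling_map R A phi) (tile (w', t)) =
          tile (sub_shift k%:Z (iter i (@sub_subst A phi) w'), s)].
Proof.
move=> ww t1.
have sub0 (v : subshift phi) : v = sub_shift 0%:Z v by apply: val_inj; rewrite /= shift_zero.
elim: i => [|i [k [s [kw s1 t0 e e']]]]; first by exists 0%N, t; rewrite -!sub0.
rewrite !iterS e e' !tiling_map_flow.
set v := iter i _ w; set v' := iter i _ w'.
have prefix (u : subshift phi) : window (val (iter i (@sub_subst A phi) u)) 0
    (size (iter i (subst_word phi) [:: val u 0])) = iter i (subst_word phi) [:: val u 0].
  rewrite val_iter_sub_subst; have := window_iter_subst phi (val u) i 0 1.
  have -> : iter i (subst_word phi) (window (val u) (- 0%:Z) 0) = [::].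
    by elim: (i) => //= j ->.
  by rewrite /= add0n oppr0 /window /mkseq /= addr0.
have wk m : (m <= k.+1)%N -> window (val v) 0 m = window (val v') 0 m.
  move=> mk; have := prefix w'; rewrite -ww -(prefix w) -/v -/v'.
  move=> /(congr1 (take m)); rewrite size_window -(subnKC (leq_trans mk kw)) !window_cat.
  by rewrite !take_size_cat ?size_window.
have vk : val v k = val v' k.
  have := wk k.+1 (leqnn _); rewrite -addn1 !window_cat => /(congr1 (drop k)).
  by rewrite !drop_size_cat ?size_window // /window /mkseq /= !addr0 !add0r => -[].
have subE (u : subshift phi) : sub_subst (sub_shift k%:Z u) =
    sub_shift (size (subst_word phi (window (val u) 0 k)))%:Z (sub_subst u).
  by apply: val_inj; rewrite /= subst_seq_shiftn.
have -> : val (sub_shift k%:Z v) 0 = val v k by rewrite /= /shift add0r.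
have -> : val (sub_shift k%:Z v') 0 = val v k by rewrite /= /shift add0r.
set L := size (phi _).
have /andP[s0 _] := unit_interval_bounds s.
have L0 : (0 < L)%N by rewrite lt0n size_eq0 subst_letter_neq0.
have [l lE] : exists l : nat, Num.floor (L%:R * val s) = l%:Z.
  by exists (absz (Num.floor (L%:R * val s))); rewrite gez0_abs // floor_ge0 mulr_ge0.
have lL : (l < L)%N.
  rewrite -(ltr_nat R); apply: le_lt_trans (_ : L%:R * val s < _).
    by have := floor_le (L%:R * val s); rewrite lE -pmulrn.
  by rewrite gtr_pMr // ltr0n.
have shiftE (u : subshift phi) m : sub_shift l%:Z (sub_shift m%:Z u) = sub_shift (l + m)%N%:Z u.
  by apply: val_inj; rewrite /= shift_shift PoszD.
exists (l + size (subst_word phi (window (val v) 0 k)))%N, (fracpart (L%:R * val s)).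
rewrite /flow lE !subE !shiftE -(wk k) //; split=> //.
- apply: leq_trans (_ : size (subst_word phi (window (val v) 0 k.+1)) <= _)%N.
    rewrite -[k.+1]addn1 window_cat subst_word_cat size_cat addnC ltn_add2l.
    rewrite (_ : subst_word phi (window (val v) (0 + k%:Z) 1) = phi (val v k)) //.
    by rewrite /window /mkseq /= /subst_word /= cats0 addr0 add0r.
  have := prefix w; rewrite /= => <-; rewrite -/v -(subnKC kw) window_cat subst_word_cat size_cat.
  exact: leq_addr.
- by rewrite /= ltrBlDl -intrD1 floorD1_gt.
move=> /t0[k0 sz]; move: lE; rewrite /= sz mulr0 floor0 => -[<-]; rewrite subrr.
by rewrite k0.
Qed.

(** Going back [k] steps and forward again, the origin lies in the image of [v_0]
    in [phi^k(v)], and the legal words of length [N] on its two sides have long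
    images.  At a vertex the origin is the left end of that image, so that the
    word starting with [v_0] serves; inside an edge the word after [v_0] is
    needed, and it is seen by the collared letter at [0]. *)
Lemma limit_seq_inj (b : A) : tame phi -> recognisable R phi ->
  injective (limit_seq (R := R) (phi := phi) b (collar_radius phi)).
Proof.
move=> tphi rphi x y exy; set N := collar_radius phi in exy.
have pxy i : collared_proj b N (iter i (@tiling_map_inv R A phi) x) =
             collared_proj b N (iter i (@tiling_map_inv R A phi) y).
  exact: (congr1 (fun f => f i) exy).
have iterK i : cancel (iter i (@tiling_map_inv R A phi)) (iter i (@tiling_map R A phi)).
  by elim: i => // i IH z; rewrite iterSr iterS tiling_map_invK IH.
have N0 : (0 < N)%N := collar_radius_gt0 phi.
have [w [t [t1 xE]]] := tile_surj x; have [w' [t' [t1' yE]]] := tile_surj y.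
have tt : t = t'.
  by have := pxy 0%N; rewrite /= xE yE => /(collared_proj_agree t1 t1')[].
suff ww : w = w' by rewrite xE yE tt ww.
apply: val_inj; apply/funext => j.
(* To compare the letters at j, go back until N letters substitute to more than
   |j| letters. *)
have [k kP] := legal_growth (absz j).+1 tphi.
have [v [s [s1 vE]]] := tile_surj (iter k (@tiling_map_inv R A phi) x).
have [v' [s' [s1' vE']]] := tile_surj (iter k (@tiling_map_inv R A phi) y).
have := pxy k; rewrite vE vE' => /(collared_proj_agree s1 s1')[ss vv].
have v0 : val v 0 = val v' 0 by apply: vv; lia.
have [l [r [lv r1 l0 e e']]] := iter_tiling_map_tile k v0 s1.
move: (iterK k x) (iterK k y); rewrite vE vE' -ss e e' xE yE.
move=> /tile_inj-/(_ r1 t1)[<- _] /tile_inj-/(_ r1 t1')[<- _].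
rewrite /= /shift !val_iter_sub_subst.
set m := (N + (0 < val s)%R)%N.
have legw i : (absz j < size (iter k (subst_word phi) (window (val v) i N)))%N.
  apply: kP; last by rewrite size_window.
  by apply: legal_window; exact: set_mem (valP v).
apply: (@iter_subst_agree _ _ _ _ k N m).
- apply: (@eq_from_nth _ (val v 0)) => [|i]; rewrite !size_window // => iNm.
  rewrite !nth_window //; apply: vv; first by lia.
  by move: iNm; rewrite /m; case: (0 < _) => /=; lia.
- apply: (@le_trans _ _ (- (absz j)%:Z)); last by lia.
  by rewrite lerN2 lez_nat; apply/ltnW/legw.
rewrite /m; have /andP[] := unit_interval_bounds s; rewrite le_eqVlt => /predU1P[s0|s0] _.
  have [-> _] := l0 (esym s0).
  rewrite -s0 ltxx addn0; apply: (@le_lt_trans _ _ (absz j)%:Z); first by lia.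
  by rewrite ltz_nat; apply: legw.
(* The origin lies l letters into the image of v_0, and the image of the N letters
   after v_0 provides the margin to the right. *)
rewrite s0 addn1 -add1n window_cat iter_subst_cat size_cat.
have -> : window (val v) 0 1 = [:: val v 0] by rewrite /window /mkseq /= addr0.
apply: (@le_lt_trans _ _ ((absz j)%:Z + l%:Z)); first by lia.
by rewrite addnC PoszD ltrD // ltz_nat.
Qed.

End Injectivity.

(** * The homeomorphism *)

Section InverseLimit.
Context (R : realType) {A : finType} (phi : substitution A) (b : A) (n : nat).

Local Notation proj := (@collared_proj R A phi b n).
Local Notation phi_inv := (@tiling_map_inv R A phi).

Lemma hausdorff_inverse_limit (T : topologicalType) (f : T -> T) :
  hausdorff_space T -> hausdorff_space (set_type (inverse_limit f)).
Proof.
move=> hT; apply: (@hausdorff_inj _ _ (fun z : set_type (inverse_limit f) => val z)).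
- exact: initial_continuous.
- exact: val_inj.
- exact: (@hausdorff_product nat (fun=> T)).
Qed.

Lemma collared_map_iter_inv (x : tiling_space R phi) i :
  collared_map (proj (iter i.+1 phi_inv x)) = proj (iter i phi_inv x).
Proof.
have := congr1 (fun f => f (iter i.+1 phi_inv x)) (collared_map_proj R phi b n).
by rewrite /= tiling_map_invK.
Qed.

Lemma limit_seq_inverse_limit x :
  inverse_limit (@collared_map R A phi b n) (limit_seq b n x).
Proof. by move=> i; apply: collared_map_iter_inv. Qed.

Context (rphi : recognisable R phi).

Lemma iter_inv_continuous i : continuous (iter i phi_inv).
Proof.
elim: i => [|i IH]; first by move=> x; exact: cvg_id.
exact: (continuous_compose IH (tiling_map_inv_continuous rphi)).
Qed.

Lemma collared_proj_iter_inv_continuous i :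
  continuous (fun x => proj (iter i phi_inv x)).
Proof.
apply: (@continuous_compose _ _ _ (iter i phi_inv) proj).
  exact: iter_inv_continuous.
exact: collared_proj_continuous.
Qed.

Lemma limit_seq_continuous : continuous (@limit_seq R A phi b n).
Proof. exact: (continuous_ptws collared_proj_iter_inv_continuous). Qed.

(** The sets are non-empty since both [phi] and the projection are onto, and
    nested since the projections intertwine [phi] with the bonding map. *)
Lemma limit_seq_surj z : inverse_limit (@collared_map R A phi b n) z ->
  exists x, limit_seq b n x = z.
Proof.
move=> zlim; pose K i := [set x | proj (iter i phi_inv x) = z i].
have hG : hausdorff_space (collared_complex R phi b n) by exact: hausdorff_ap_complex.
have [i|i|i|x Kx] := @compact_nested _ K (@compact_tiling_space R A phi).
- have clz : closed [set z i].
    by apply: accessible_closed_set1; apply: hausdorff_accessible.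
  by have /continuous_closedP/(_ _ clz) := @collared_proj_iter_inv_continuous i.
- have [y yz] := collared_proj_surj (z i).
  exists (iter i (@tiling_map R A phi) y); rewrite /K /=.
  suff -> : iter i phi_inv (iter i (@tiling_map R A phi) y) = y by [].
  by elim: (i) => // j IH; rewrite iterSr iterS (tiling_mapK rphi).
- by move=> x Kx; rewrite /K /= -collared_map_iter_inv Kx zlim.
- by exists x; apply/funext => i; apply: Kx.
Qed.

End InverseLimit.

Theorem theorem4p5 (R : realType) (A : finType) (phi : substitution A) (b : A) :
  tame phi -> recognisable R phi ->
  exists h : tiling_space R phi ->
             set_type (inverse_limit (@collared_map R A phi b (collar_radius phi))),
    (forall x, val (h x) = limit_seq b (collar_radius phi) x) /\
    homeomorphism h.
Proof.
move=> tphi rphi; set n := collar_radius phi.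
pose h x : set_type (inverse_limit (@collared_map R A phi b n)) :=
  exist _ (limit_seq b n x) (mem_set (limit_seq_inverse_limit b n x)).
exists h; split=> //.
have h_inj : injective h by move=> x y /(congr1 val); apply: limit_seq_inj.
have /choice[g hg] z : exists x, h x = z.
  have [x xz] := limit_seq_surj rphi (set_mem (valP z)).
  by exists x; apply: val_inj.
have gh : cancel h g by move=> x; apply: h_inj; rewrite hg.
have h_cont : continuous h.
  by apply: continuous_set_type; apply: limit_seq_continuous.
split=> //; exists g; split=> //.
apply: (continuous_compact_inverse _ _ h_cont gh hg).
  exact: compact_tiling_space.
by apply: hausdorff_inverse_limit; apply: hausdorff_ap_complex.
Qed.
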